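(* Let $s>0$, $p\in(0,\infty)$, $q\in(0,\infty]$, $u\in[1,\infty]$, let $\mathcal P$ be a grid of a finite measure space $(I,\mathbb A,m)$ satisfying (G1) and (G2), and let $\mathcal A$ be a family of atoms of type $(s,p,u)$ satisfying (A1)-(A4). Assume moreover that either (1) for every $Q\in\mathcal P$ the set $\mathcal A(Q)$ is compact in the strong topology of $L^p$; or (2) $p\ge1$ and for every $Q\in\mathcal P$ the set $\mathcal A(Q)$ is sequentially compact in the weak topology of $L^p$. Then: i. Let $g_n\in\mathcal B^s_{p,q}(\mathcal A)$ be such that $|g_n|_{\mathcal B^s_{p,q}(\mathcal A)}\le C$ for every $n$. Then there is a subsequence that converges strongly in $L^p$ (in case (1)), respectively weakly in $L^p$ (in case (2)), to some $g\in\mathcal B^s_{p,q}(\mathcal A)$ with $|g|_{\mathcal B^s_{p,q}(\mathcal A)}\le C$. ii. In both cases $(\mathcal B^s_{p,q}(\mathcal A),|\cdot|_{\mathcal B^s_{p,q}(\mathcal A)})$ is a complex $\rho$-Banach space, with $\rho=\min\{1,p,q\}$. iii. In case (1) the inclusion $\imath:(\mathcal B^s_{p,q}(\mathcal A),|\cdot|_{\mathcal B^s_{p,q}(\mathcal A)})\to(L^p,|\cdot|_p)$ is a compact linear inclusion.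
   Context: Notation: $|J|=m(J)$; $|\cdot|_p$ is the (quasi-)norm of $L^p=L^p(I,\mathbb A,m)$; $\mathbb N=\{0,1,\dots\}$; $\hat t=\max\{1,t\}$; $r'$ is the conjugate exponent ($\infty'=1$, $1'=\infty$); sup modification when $q=\infty$. A $\rho$-norm is a function $|\cdot|$ with $|\gamma f|=|\gamma||f|$, $|f+g|^\rho\le|f|^\rho+|g|^\rho$ and $|f|=0\Rightarrow f=0$; a $\rho$-Banach space is one that is complete for the metric $|f-g|^\rho$. Grid: a sequence $\mathcal P=(\mathcal P^k)_{k\in\mathbb N}$ of finite families of measurable subsets of $I$ of positive measure, at least one non-empty, with (G1) $\sup_k\sup_{Q\in\mathcal P^k}\#\{P\in\mathcal P^k:P\cap Q\ne\emptyset\}<\infty$. Sets in different levels are assumed distinct; $\mathcal P$ also denotes $\bigcup_k\mathcal P^k$; $|\mathcal P^k|=\sup\{|Q|:Q\in\mathcal P^k\}$. For a non-negative sequence $b$, $\Gamma(t,q,b)$ is: $(\sum_k b_k^{q'/t})^{1/q'}$ if $t\ge1,q>1$; $\sup_kb_k^{1/t}$ if $t\ge1,q\le1$; $(\sum_kb_k^{(q/t)'})^{1/(t(q/t)')}$ if $t<1,q>t$; $\sup_kb_k^{1/t}$ if $t<1,q\le t$. (G2): $\Gamma(p,q,(|\mathcal P^k|^{sp})_k)<\infty$ and $\lim_k|\mathcal P^k|=0$. Family of atoms of type $(s,p,u)$: $\mathcal A=(\mathcal B(Q),\mathcal A(Q))_{Q\in\mathcal P}$ such that (A1) $\mathcal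 B(Q)$ is a complex Banach space contained in $L^{pu}$; (A2) every $\phi\in\mathcal B(Q)$ vanishes outside $Q$; (A3) $\mathcal A(Q)$ is a non-empty convex subset of $\mathcal B(Q)$, and $\phi\in\mathcal A(Q)$ iff $\sigma\phi\in\mathcal A(Q)$ for every $\sigma\in\mathbb C$, $|\sigma|=1$; (A4) $|\phi|_{pu}\le|Q|^{s-\frac1{u'p}}$ for every $\phi\in\mathcal A(Q)$. $\mathcal B^s_{p,q}(\mathcal A)$: the set of complex $g\in L^p$ with $g=\sum_k\sum_{Q\in\mathcal P^k}s_Qa_Q$, $a_Q\in\mathcal A(Q)$, $s_Q\in\mathbb C$, converging absolutely in $L^p$ in the sense $\sum_k|\sum_{Q\in\mathcal P^k}s_Qa_Q|_p^{p/\hat p}<\infty$, and with finite cost $(\sum_k(\sum_{Q\in\mathcal P^k}|s_Q|^p)^{q/p})^{1/q}$; $|g|_{\mathcal B^s_{p,q}(\mathcal A)}$ is the infimum of the costs. *)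

(* Defs.v *)
From HB Require Import structures.
From mathcomp Require Import all_boot all_order all_algebra finmap.
From mathcomp Require Import generic_quotient ring_quotient.
From mathcomp Require Import complex.
From mathcomp Require Import all_classical all_reals all_analysis.
From mathcomp Require Import measurable_realfun.

Set Implicit Arguments.
Unset Strict Implicit.
Unset Printing Implicit Defensive.

Import Order.TTheory GRing.Theory Num.Theory.
Import numFieldNormedType.Exports.
Import Quotient.Exports.

Local Open Scope classical_set_scope.
Local Open Scope ring_scope.
Local Open Scope quotient_scope.

Notation normc := Normc.normc.

Section complex_functions.
Context d (T : measurableType d) (R : realType).
Variable mu : {measure set T -> \bar R}.
Implicit Types (f g : T -> R[i]) (p : R).

(* R[i] carries no measurableType structure; its Borel sigma-algebra is the
   product one, so measurability is that of the real and imaginary parts. *)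
Definition cmeasurable f :=
  measurable_fun setT (fun x => complex.Re (f x)) /\
  measurable_fun setT (fun x => complex.Im (f x)).

Definition cLnorm (r : \bar R) f : \bar R :=
  Lnorm mu r (fun x => (normc (f x))%:E).

Lemma normc_ge0 (z : R[i]) : 0 <= normc z.
Proof. by case: z => a b /=; rewrite sqrtr_ge0. Qed.

Lemma measurable_normc f : cmeasurable f ->
  measurable_fun setT (fun x => normc (f x)).
Proof.
move=> [mr mi].
rewrite (_ : (fun x => _) =
  (fun x => (complex.Re (f x) ^+ 2 + complex.Im (f x) ^+ 2) `^ 2^-1)); last first.
  apply/funext => x; rewrite powR12_sqrt ?addr_ge0 ?sqr_ge0//.
  by case: (f x).
apply: (@measurableT_comp _ _ _ _ _ _ (@powR R ^~ 2^-1)) => //.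
by apply: measurable_funD; exact: measurable_funX.
Qed.

Lemma cmeasurableD f g : cmeasurable f -> cmeasurable g ->
  cmeasurable (f \+ g).
Proof.
move=> [fr fi] [gr gi]; split.
- rewrite (_ : (fun x => _) = (fun x => complex.Re (f x) + complex.Re (g x))).
    exact: measurable_funD.
  by apply/funext => x /=; case: (f x); case: (g x).
- rewrite (_ : (fun x => _) = (fun x => complex.Im (f x) + complex.Im (g x))).
    exact: measurable_funD.
  by apply/funext => x /=; case: (f x); case: (g x).
Qed.

Lemma cmeasurableZ (a : R[i]) f : cmeasurable f ->
  cmeasurable (fun x => a * f x).
Proof.
case: a => a b [fr fi]; split.
- rewrite (_ : (fun x => _) =
    (fun x => a * complex.Re (f x) - b * complex.Im (f x))).
    by apply: measurable_funB; exact: measurable_funM.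
  by apply/funext => x; case: (f x).
- rewrite (_ : (fun x => _) =
    (fun x => a * complex.Im (f x) + b * complex.Re (f x))).
    by apply: measurable_funD; exact: measurable_funM.
  by apply/funext => x; case: (f x) => c e /=.
Qed.

Lemma cmeasurable0 : cmeasurable (fun=> 0).
Proof. by split => /=; exact: measurable_cst. Qed.

Lemma cLnorm_ge0 r f : (0 <= cLnorm r f)%E.
Proof. exact: Lnorm_ge0. Qed.

Lemma measurable_normc_powR f p : cmeasurable f ->
  measurable_fun setT (fun x => ((normc (f x)) `^ p)%:E).
Proof.
move=> mf; apply/measurable_EFinP.
apply: (@measurableT_comp _ _ _ _ _ _ (@powR R ^~ p)) => //.
exact: measurable_normc.
Qed.

Lemma cLnorm_powR f p : 0 < p ->
  (cLnorm p%:E f `^ p = \int[mu]_x ((normc (f x)) `^ p)%:E)%E.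
Proof.
move=> p0; rewrite /cLnorm poweR_Lnorm ?gt_eqF//.
by apply: eq_integral => x _ /=; rewrite ger0_norm ?normc_ge0// poweR_EFin.
Qed.

Lemma cLnorm_ae_eq f g p : 0 < p -> cmeasurable f -> cmeasurable g ->
  {ae mu, forall x, f x = g x} -> cLnorm p%:E f = cLnorm p%:E g.
Proof.
move=> p0 mf mg fg.
have H : (cLnorm p%:E f `^ p = cLnorm p%:E g `^ p)%E.
  rewrite !cLnorm_powR//; apply: ae_eq_integral => //; try exact: measurable_normc_powR.
  by apply: filterS fg => x /= -> _.
have := congr1 (fun x => x `^ p^-1)%E H.
by rewrite -!poweRrM divff ?gt_eqF// !poweRe1 ?cLnorm_ge0.
Qed.

Lemma cLnormZ (a : R[i]) f p : 0 < p -> cmeasurable f ->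
  cLnorm p%:E (fun x => a * f x) = ((normc a)%:E * cLnorm p%:E f)%E.
Proof.
move=> p0 mf.
have H : (cLnorm p%:E (fun x => a * f x)%R `^ p =
          ((normc a)%:E * cLnorm p%:E f) `^ p)%E.
  rewrite poweRM ?lee_fin ?normc_ge0 ?cLnorm_ge0// !cLnorm_powR// poweR_EFin.
  rewrite -ge0_integralZl//; last 3 first.
  - exact: measurable_normc_powR.
  - by move=> x _; rewrite lee_fin powR_ge0.
  - by rewrite lee_fin powR_ge0.
  by apply: eq_integral => x _; rewrite Normc.normcM powRM ?normc_ge0// EFinM.
have := congr1 (fun x => x `^ p^-1)%E H.
rewrite -!poweRrM divff ?gt_eqF// !poweRe1 ?cLnorm_ge0//.
by rewrite mule_ge0 ?cLnorm_ge0// lee_fin normc_ge0.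
Qed.

Lemma le_powRD (a b r : R) : 0 <= a -> 0 <= b -> 0 < r <= 1 ->
  (a + b) `^ r <= a `^ r + b `^ r.
Proof.
move=> a0 b0 /andP[r0 r1].
have [->|an0] := eqVneq a 0; first by rewrite add0r powR0 ?gt_eqF// add0r.
have ab0 : 0 < a + b by rewrite ltr_wpDr// lt0r an0.
have key x : 0 <= x -> x <= a + b -> x / (a + b) <= (x / (a + b)) `^ r.
  move=> x0 xab; have [->|xn0] := eqVneq x 0.
    by rewrite mul0r powR_ge0.
  have xab0 : 0 < x / (a + b) <= 1.
    have xp : 0 < x by rewrite lt0r xn0.
    by rewrite divr_gt0//= ler_pdivrMr// mul1r.
  rewrite -{1}[x / _]powRr1 ?(ltW (andP xab0).1)//.
  exact: (@ger_powR _ (x / (a + b))).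
have H : 1 <= (a / (a + b)) `^ r + (b / (a + b)) `^ r.
  rewrite -[leLHS](@divff _ (a + b)) ?gt_eqF// mulrDl lerD//.
    by rewrite key// lerDl.
  by rewrite key// lerDr.
have := ler_wpM2l (powR_ge0 (a + b) r) H.
rewrite mulr1 mulrDr -!powRM ?divr_ge0 ?(ltW ab0)//.
by rewrite ![(a + b) * _]mulrC !divfK ?gt_eqF.
Qed.

Lemma cLnormD f g p : 0 < p -> cmeasurable f -> cmeasurable g ->
  (cLnorm p%:E (f \+ g)%R `^ (Num.min 1 p)%R <=
   cLnorm p%:E f `^ (Num.min 1 p)%R + cLnorm p%:E g `^ (Num.min 1 p)%R)%E.
Proof.
move=> p0 mf mg; have [p1|p1] := leP 1 p.
  rewrite !poweRe1 ?cLnorm_ge0//.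
  apply: (le_trans _ (@minkowski_EFin _ _ _ mu _ _ p
    (measurable_normc mf) (measurable_normc mg) p1)).
  rewrite /cLnorm unlock.
  apply: gt0_ler_poweR.
  - by rewrite invr_ge0 ltW.
  - by rewrite in_itv/= leey andbT integral_ge0// => x _; rewrite poweR_ge0.
  - by rewrite in_itv/= leey andbT integral_ge0// => x _; rewrite poweR_ge0.
  have mp (h : T -> R) : measurable_fun setT h ->
      measurable_fun setT (fun x => `|(h x)%:E| `^ p)%E.
    move=> mh; apply: (@measurableT_comp _ _ _ _ _ _ (fun x => x `^ p)%E) => //.
      exact: measurable_poweR.
    by apply: measurableT_comp => //; exact/measurable_EFinP.
  apply: ge0_le_integral => //=.
  - apply: (mp (fun x => normc (f x + g x))); apply: measurable_normc.
    exact: cmeasurableD.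
  - apply: (mp (fun x => normc (f x) + normc (g x))).
    by apply: measurable_funD; exact: measurable_normc.
  move=> x _; rewrite lee_fin ge0_ler_powR ?(ltW p0)// ?nnegrE// !ger0_norm ?addr_ge0 ?normc_ge0//.
  exact: le_normcD.
rewrite !cLnorm_powR// -ge0_integralD//; last 4 first.
- by move=> x _; rewrite lee_fin powR_ge0.
- exact: measurable_normc_powR.
- by move=> x _; rewrite lee_fin powR_ge0.
- exact: measurable_normc_powR.
apply: ge0_le_integral => //=.
- by move=> x _; rewrite lee_fin powR_ge0.
- by apply: measurable_normc_powR; exact: cmeasurableD.
- by apply: emeasurable_funD; exact: measurable_normc_powR.
move=> x _; rewrite lee_fin (le_trans _ (le_powRD _ _ _)) ?normc_ge0 ?p0 ?(ltW p1)//.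
rewrite ge0_ler_powR ?(ltW p0)// ?nnegrE ?addr_ge0 ?normc_ge0//.
exact: le_normcD.
Qed.

End complex_functions.

Section Lp_space.
Context d (T : measurableType d) (R : realType).
Variables (mu : {measure set T -> \bar R}) (p : R) (p0 : 0 < p).

(* The unused proof of 0 < p is an argument so that the canonical instances
   below, which need it, can be inferred from the type alone. *)
Definition cLfun_pred (_ : 0 < p) : {pred T -> R[i]} :=
  [pred f | `[< cmeasurable f /\ (cLnorm mu p%:E f < +oo)%E >]].

Local Notation cLfun := (cLfun_pred p0).

Lemma cLfunP f :
  reflect (cmeasurable f /\ (cLnorm mu p%:E f < +oo)%E) (f \in cLfun).
Proof. by rewrite inE; exact: asboolP. Qed.

Let rho_gt0 : 0 < Num.min 1 p. Proof. by rewrite lt_min ltr01. Qed.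

Lemma cLfun_submod_closed : submod_closed cLfun.
Proof.
split=> [|a f g /cLfunP[mf lf] /cLfunP[mg lg]].
  apply/cLfunP; split; first exact: cmeasurable0.
  rewrite /cLnorm (_ : (fun x => _) = cst 0%E) ?Lnorm0 ?eqe ?gt_eqF//.
  by apply/funext => x; rewrite -[LHS]/(normc (0 : R[i]))%:E Normc.normc0.
apply/cLfunP; split.
  by apply: cmeasurableD => //; exact: cmeasurableZ.
have maf := cmeasurableZ a mf.
rewrite ltey; apply/negP => /eqP E.
have := cLnormD mu p0 maf mg.
rewrite [X in (X `^ _)%E](_ : _ = +oo%E)// poweRyr ?gt_eqF//.
rewrite leye_eq => /eqP; apply/eqP; rewrite -ltey lte_add_pinfty// poweR_lty//.
by rewrite cLnormZ// lte_mul_pinfty// lee_fin normc_ge0.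
Qed.

HB.instance Definition _ :=
  GRing.isSubmodClosed.Build _ _ cLfun cLfun_submod_closed.

Record LfunC : Type := MkLfunC { LfunC_val :> T -> R[i]; _ : LfunC_val \in cLfun }.
HB.instance Definition _ := [isSub for LfunC_val].
HB.instance Definition _ := [Choice of LfunC by <:].
HB.instance Definition _ := [SubChoice_isSubLmodule of LfunC by <:].

Definition ae_null : {pred LfunC} :=
  [pred f : LfunC | `[< {ae mu, forall x, f x = 0} >]].

Lemma ae_nullP (f : LfunC) : reflect {ae mu, forall x, f x = 0} (f \in ae_null).
Proof. by rewrite inE; exact: asboolP. Qed.

Lemma ae_null_zmod_closed : zmod_closed ae_null.
Proof.
split=> [|f g /ae_nullP f0 /ae_nullP g0]; apply/ae_nullP.
  by apply: aeW.
by apply: filterS2 f0 g0 => x /= f0 g0; rewrite -[LHS]/(f x - g x) f0 g0 subrr.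
Qed.

HB.instance Definition _ :=
  GRing.isZmodClosed.Build _ ae_null ae_null_zmod_closed.

(* L^p(T, C) for 0 < p < oo, as classes modulo a.e. equality; the library's
   LspaceType is real-valued and restricted to p >= 1. *)
Definition Lp : Type := Quotient.quot ae_null.
HB.instance Definition _ := GRing.Zmodule.on Lp.
HB.instance Definition _ := ZmodQuotient.on Lp.

Definition Lp_fun (f : Lp) : T -> R[i] := repr f.
Coercion Lp_fun : Lp >-> Funclass.

Lemma pi_LpP (f g : LfunC) :
  \pi_Lp f = \pi_Lp g <-> {ae mu, forall x, f x = g x}.
Proof.
split=> [/eqP|fg].
  rewrite -Quotient.idealrBE => /ae_nullP; apply: filterS => x /= fg.
  by apply/eqP; rewrite -subr_eq0; apply/eqP; exact: fg.
apply/eqP; rewrite -Quotient.idealrBE; apply/ae_nullP.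
by apply: filterS fg => x /= fg; rewrite -[LHS]/(f x - g x) fg subrr.
Qed.

Lemma Lp_fun_pi (f : LfunC) : {ae mu, forall x, (\pi_Lp f : Lp) x = f x}.
Proof. by apply/pi_LpP; rewrite reprK. Qed.

Lemma LpP (f g : Lp) : f = g <-> {ae mu, forall x, f x = g x}.
Proof. by rewrite -pi_LpP !reprK. Qed.

Lemma Lp_cmeasurable (f : Lp) : cmeasurable f.
Proof. by rewrite /Lp_fun; case: (repr f) => h /= /cLfunP[]. Qed.

Lemma Lp_cLnorm_lty (f : Lp) : (cLnorm mu p%:E f < +oo)%E.
Proof. by rewrite /Lp_fun; case: (repr f) => h /= /cLfunP[]. Qed.

Lemma Lp_funD (f g : Lp) : {ae mu, forall x, (f + g : Lp) x = f x + g x}.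
Proof.
have -> : f + g = \pi_Lp (repr f + repr g) by rewrite raddfD /= !reprK.
exact: Lp_fun_pi.
Qed.

Definition scale_Lp (a : R[i]) (f : Lp) : Lp := \pi_Lp (a *: repr f).

Lemma scale_LpE a f : {ae mu, forall x, scale_Lp a f x = a * f x}.
Proof. exact: Lp_fun_pi. Qed.

Lemma scale_Lp_pi a (f : LfunC) : scale_Lp a (\pi_Lp f) = \pi_Lp (a *: f).
Proof.
apply/pi_LpP; apply: filterS (Lp_fun_pi f) => x fx.
exact: (congr1 (fun z => a * z) fx).
Qed.

Lemma scale_LpA a b f : scale_Lp a (scale_Lp b f) = scale_Lp (a * b) f.
Proof. by elim/quotW: f => f; rewrite (scale_Lp_pi b f) !scale_Lp_pi scalerA. Qed.

Lemma scale_Lp1 : left_id 1 scale_Lp.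
Proof. by elim/quotW=> f; rewrite scale_Lp_pi scale1r. Qed.

Lemma scale_LpDr : right_distributive scale_Lp +%R.
Proof.
move=> a; elim/quotW=> f; elim/quotW=> g.
by rewrite -raddfD !scale_Lp_pi scalerDr raddfD.
Qed.

Lemma scale_LpDl f : {morph scale_Lp^~ f : a b / a + b}.
Proof. by elim/quotW: f => f a b; rewrite !scale_Lp_pi scalerDl raddfD. Qed.

HB.instance Definition _ := GRing.Zmodule_isLmodule.Build R[i] Lp
  scale_LpA scale_Lp1 scale_LpDr scale_LpDl.

(* |f|_r for an arbitrary exponent r; +oo when f is not in L^r. *)
Definition Lp_enorm (r : \bar R) (f : Lp) : \bar R := cLnorm mu r f.

Definition Lp_norm (f : Lp) : R := fine (Lp_enorm p%:E f).

Lemma Lp_norm_ge0 f : 0 <= Lp_norm f.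
Proof. by rewrite fine_ge0 ?cLnorm_ge0. Qed.

Lemma Lp_normE f : (Lp_norm f)%:E = cLnorm mu p%:E f.
Proof. by rewrite fineK// ge0_fin_numE ?cLnorm_ge0// Lp_cLnorm_lty. Qed.

Lemma Lp_normZ a (f : Lp) : Lp_norm (a *: f) = normc a * Lp_norm f.
Proof.
apply: EFin_inj; rewrite EFinM !Lp_normE -cLnormZ//; last exact: Lp_cmeasurable.
apply: cLnorm_ae_eq => //; first exact: Lp_cmeasurable.
  by apply: cmeasurableZ; exact: Lp_cmeasurable.
exact: scale_LpE.
Qed.

Lemma Lp_normN (f : Lp) : Lp_norm (- f) = Lp_norm f.
Proof. by rewrite -scaleN1r Lp_normZ normcN Normc.normc1 mul1r. Qed.

Lemma Lp_norm0 : Lp_norm 0 = 0.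
Proof. by rewrite -(scale0r 0) Lp_normZ Normc.normc0 mul0r. Qed.

Lemma Lp_norm_eq0 (f : Lp) : Lp_norm f = 0 -> f = 0.
Proof.
move=> f0; have E : cLnorm mu p%:E f = 0%E by rewrite -Lp_normE f0.
have mf : measurable_fun setT (fun x => (normc (f x))%:E).
  by apply/measurable_EFinP/measurable_normc; exact: Lp_cmeasurable.
have p0' : (0 < p%:E)%E by rewrite lte_fin.
have /= H := Lnorm_eq0_eq0 mf p0' E.
apply/LpP; rewrite -(scale0r f).
apply: filterS2 H (scale_LpE 0 f) => x fx ->.
by rewrite mul0r; apply: Normc.eq0_normc; case: (fx I).
Qed.

Lemma Lp_normD (f g : Lp) : Lp_norm (f + g) `^ Num.min 1 p <=
  Lp_norm f `^ Num.min 1 p + Lp_norm g `^ Num.min 1 p.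
Proof.
rewrite -lee_fin EFinD -!poweR_EFin !Lp_normE.
rewrite (@cLnorm_ae_eq _ _ _ mu _ (Lp_fun f \+ Lp_fun g) p)//.
- by apply: cLnormD => //; exact: Lp_cmeasurable.
- exact: Lp_cmeasurable.
- by apply: cmeasurableD; exact: Lp_cmeasurable.
- exact: Lp_funD.
Qed.

(* For p < 1 only |f - g|_p ^ p is a metric; for p >= 1 this is |f - g|_p. *)
Definition Lp_dist (f g : Lp) : R := Lp_norm (f - g) `^ Num.min 1 p.

Lemma Lp_distxx f : Lp_dist f f = 0.
Proof. by rewrite /Lp_dist subrr Lp_norm0 powR0// gt_eqF. Qed.

Lemma Lp_dist_eq0 f g : Lp_dist f g = 0 -> f = g.
Proof.
by move/powR_eq0_eq0/Lp_norm_eq0/eqP; rewrite subr_eq0 => /eqP.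
Qed.

Lemma Lp_dist_sym f g : Lp_dist f g = Lp_dist g f.
Proof. by rewrite /Lp_dist -opprB Lp_normN. Qed.

Lemma Lp_dist_triangle g f h : Lp_dist f h <= Lp_dist f g + Lp_dist g h.
Proof. by rewrite /Lp_dist -(subrKA g) Lp_normD. Qed.

HB.instance Definition _ := isMetric.Build R Lp
  Lp_distxx Lp_dist_eq0 Lp_dist_sym Lp_dist_triangle.

End Lp_space.

Section rho_banach.
Context (R : realType) (V : lmodType R[i]).
Implicit Types (S : set V) (N : V -> R) (rho : R).

(* All notions are relative to a subset S of V, so that a space contained in V
   can carry a norm N of its own; the values of N outside S are irrelevant. *)
Definition rho_norm rho S N :=
  [/\ forall f, S f -> 0 <= N f,
      forall (a : R[i]) f, S f -> N (a *: f) = normc a * N f,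
      forall f g, S f -> S g -> N (f + g) `^ rho <= N f `^ rho + N g `^ rho
    & forall f, S f -> N f = 0 -> f = 0].

Definition rho_complete rho S N :=
  forall u : nat -> V, (forall n, S (u n)) ->
  (forall e, 0 < e -> exists n0, forall m n, (n0 <= m)%N -> (n0 <= n)%N ->
     N (u m - u n) `^ rho < e) ->
  exists2 f, S f & N (u n - f) `^ rho @[n --> \oo] --> 0.

Definition rho_banach rho S N :=
  [/\ S 0,
      forall (a : R[i]) f g, S f -> S g -> S (a *: f + g),
      rho_norm rho S N
    & rho_complete rho S N].

Definition banach S N := rho_banach 1 S N.

End rho_banach.

Section weak_topology.
Context d (T : measurableType d) (R : realType).
Variables (mu : {measure set T -> \bar R}) (p : R) (p0 : 0 < p).

Definition Lp_dual :=
  {phi : Lp mu p0 -> R[i]^o | linear phi /\ continuous phi}.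

(* sigma(L^p, (L^p)'): the coarsest topology making every phi continuous. *)
Definition weak_Lp := sup_topology
  (fun phi : Lp_dual => Topological.class (initial_topology (sval phi))).

HB.instance Definition _ := Topological.on weak_Lp.

Lemma weak_cvgP (u : nat -> Lp mu p0) (f : Lp mu p0) :
  (u n : weak_Lp) @[n --> \oo] --> (f : weak_Lp) <->
  forall phi : Lp_dual, sval phi (u n) @[n --> \oo] --> sval phi f.
Proof.
split=> [/cvg_sup uf phi|uf].
  by move: (@initial_continuous _ _ (sval phi) f); exact: cvg_comp (uf phi).
apply/cvg_sup => phi A [_ [[B Bo <-] Bf BA]].
have := uf phi B (open_nbhs_nbhs (conj Bo Bf)).
rewrite !nbhs_simpl /= => uB.
by apply: (@filterS _ (u @ \oo) _ _ _ BA); exact: uB.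
Qed.

Definition weakly_sequentially_compact (A : set (Lp mu p0)) :=
  forall u : nat -> Lp mu p0, (forall n, A (u n)) ->
  exists2 k : nat -> nat, increasing_seq k &
    exists2 f : Lp mu p0, A f & (u (k n) : weak_Lp) @[n --> \oo] --> (f : weak_Lp).

(* F is linear on the subspace S and maps every N-bounded part of S to a
   relatively compact set for the strong topology of L^p. *)
Definition compact_linear_map (S : set (Lp mu p0)) (N : Lp mu p0 -> R)
    (F : Lp mu p0 -> Lp mu p0) :=
  (forall (a : R[i]) f g, S f -> S g -> F (a *: f + g) = a *: F f + F g) /\
  forall X : set (Lp mu p0), X `<=` S ->
    (exists M, forall f, X f -> N f <= M) -> precompact (F @` X).

End weak_topology.

Section grids.
Context d (T : measurableType d) (R : realType).
Variables (mu : {measure set T -> \bar R}).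
Implicit Type P : nat -> {fset set T}.

Definition in_grid P : set (set T) := [set Q | exists k, Q \in P k].

Definition grid P :=
  [/\ forall k Q, Q \in P k -> measurable Q /\ (0 < mu Q)%E,
      exists k, P k != fset0
    & forall j k Q, Q \in P j -> Q \in P k -> j = k].

Definition G1 P := exists M : nat, forall k Q, Q \in P k ->
  (#|` [fset Q' in P k | (Q' `&` Q)%classic != set0]%fset | <= M)%N.

(* sup set0 = 0, so an empty level has mesh 0. *)
Definition mesh P k : R := sup [set fine (mu Q) | Q in [set` P k]].

(* q' and (q/t)' are finite in the branches where they are used. *)
Definition Gamma (t : R) (q : \bar R) (b : nat -> R) : \bar R :=
  if 1 <= t then
    if (1 < q)%E then
      let q' := fine (hoelder_conjugate q) in
      ((\sum_(0 <= k <oo) (b k `^ (q' / t))%:E) `^ q'^-1)%E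
    else ereal_sup (range (fun k => (b k `^ t^-1)%:E))
  else
    if (t%:E < q)%E then
      let r' := fine (hoelder_conjugate (q / t%:E)) in
      ((\sum_(0 <= k <oo) (b k `^ r')%:E) `^ (t * r')^-1)%E
    else ereal_sup (range (fun k => (b k `^ t^-1)%:E)).

Definition G2 (s p : R) (q : \bar R) P :=
  (Gamma p q (fun k => mesh P k `^ (s * p))%R < +oo)%E /\
  mesh P k @[k --> \oo] --> 0.

End grids.

Section besov.
Context d (T : measurableType d) (R : realType).
Variables (mu : {measure set T -> \bar R}) (p : R) (p0 : 0 < p).
Implicit Types (P : nat -> {fset set T}) (A B : set T -> set (Lp mu p0)).

(* B(Q) is a subset of L^p with finite L^{pu} norms: when mu is finite and
   u >= 1, L^{pu} is exactly the set of f in L^p with |f|_{pu} < oo.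
   For u = 1 the conjugate exponent is +oo and 1 / (u' p) is 0. *)
Definition atoms P (s : R) (u : \bar R)
    B (NB : set T -> Lp mu p0 -> R) A :=
  forall Q, in_grid P Q ->
  [/\ banach (B Q) (NB Q) /\
        (forall f, B Q f -> (Lp_enorm (p%:E * u) f < +oo)%E),
      forall f, B Q f -> {ae mu, forall x, ~ Q x -> f x = 0},
      [/\ A Q `<=` B Q, A Q !=set0, convex_set (A Q) &
        forall f, A Q f <-> forall z : R[i], normc z = 1 -> A Q (z *: f)]
    & forall f, A Q f -> (Lp_enorm (p%:E * u) f <=
        (fine (mu Q) `^ (s - fine (hoelder_conjugate u * p%:E)^-1%E))%:E)%E].

Definition level_sum P (c : set T -> R[i]) (a : set T -> Lp mu p0) (k : nat) :
  Lp mu p0 := \sum_(Q <- P k) c Q *: a Q.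

Definition atomic_representation P A (g : Lp mu p0)
    (c : set T -> R[i]) (a : set T -> Lp mu p0) :=
  [/\ forall Q, in_grid P Q -> A Q (a Q),
      (\sum_(0 <= k <oo) (Lp_norm (level_sum P c a k) `^ (p / Num.max 1 p))%:E
        < +oo)%E
    & series (level_sum P c a) @ \oo --> g].

(* The last branch is only meant for q = +oo. *)
Definition cost P (q : \bar R) (c : set T -> R[i]) : \bar R :=
  let S k := \sum_(Q <- P k) normc (c Q) `^ p in
  if q is r%:E then
    ((\sum_(0 <= k <oo) (S k `^ (r / p))%:E) `^ r^-1)%E
  else ereal_sup (range (fun k => (S k `^ p^-1)%:E)).

Definition besov P (q : \bar R) A : set (Lp mu p0) :=
  [set g | exists c a, atomic_representation P A g c a /\ (cost P q c < +oo)%E].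

Definition besov_norm P (q : \bar R) A (g : Lp mu p0) : R :=
  fine (ereal_inf
    [set C | exists c a, atomic_representation P A g c a /\ C = cost P q c]).

End besov.

(* Main.v *)
(** Representations of elements of a bounded set of Besov functions have, after
    absorbing phases into the atoms, bounded nonnegative coefficients.  Since there are
    countably many cells, a diagonal subsequence makes every coefficient and every atom
    converge.  The cost is lower semicontinuous, and (G1), (G2) and Hoelder's inequality
    bound the tails of the representations in [L^p] uniformly in terms of the cost
    (the [k]-th level is at most a constant times [mesh_k ^ s] times the [k]-th block of
    the cost), so the sums converge along the subsequence too.  In particular the
    infimum of the costs is attained, which together with the compactness of balls
    gives the rho-norm axioms and completeness. *)

(* The strong and the weak case share one argument through [convergence_mode]: its fields are what
   is needed to pass to the limit in finitely many levels, together with stability under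
   approximation uniform in the sequence index, which absorbs the tails. Convergence cell by cell
   provides no limit function, so the limit is built as the sum of the limiting representation and
   identified afterwards. The range [p < 1] shapes the estimates: only the power [min(1, p)] of
   [Lp_norm] is subadditive, so every series is measured in that power and [l^q] becomes
   [l^(q / min(1, p))]; the two branches of [Gamma] encode its conjugate exponent. Nonnegative
   coefficients make sums tractable: [r a + r' a'] is [r + r'] times a convex combination of atoms,
   so the triangle inequality becomes one for nonnegative sequences. In the weak case, uniqueness of
   limits rests on the integrals over measurable sets, which for [p >= 1] and a finite measure are
   continuous functionals separating points. *)
Require Import Defs.
From HB Require Import structures.
From mathcomp Require Import all_boot all_order all_algebra finmap.
From mathcomp Require Import complex.
From mathcomp Require Import all_classical all_reals all_analysis.
From mathcomp Require Import measurable_realfun ess_sup_inf.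
From mathcomp Require Import ring lra.

Set Implicit Arguments.
Unset Strict Implicit.
Unset Printing Implicit Defensive.

Import Order.TTheory GRing.Theory Num.Theory.
Import numFieldNormedType.Exports.

Local Open Scope classical_set_scope.
Local Open Scope ring_scope.

(** * Sequence norms *)

Section sequence_norms.
Context {R : realType}.
Implicit Types (x y : nat -> R) (a b t r : R) (q : \bar R).

Lemma le_powR a b r : 0 <= r -> 0 <= a -> a <= b -> a `^ r <= b `^ r.
Proof.
by move=> r0 a0 ab; apply: ge0_ler_powR; rewrite ?nnegrE// (le_trans a0).
Qed.

Lemma powR_le_inv a b r : 0 < r -> 0 <= a -> 0 <= b -> a `^ r <= b `^ r -> a <= b.
Proof.
move=> r0 a0 b0 /(le_powR (r := r^-1)); rewrite -!powRrM.
by rewrite divff ?gt_eqF// !powRr1//; apply; rewrite ?invr_ge0 ?(ltW r0) ?powR_ge0.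
Qed.

Lemma le_poweR (x y : \bar R) r : 0 <= r -> (0 <= x)%E -> (x <= y)%E ->
  (x `^ r <= y `^ r)%E.
Proof.
move=> r0 x0 xy; apply: gt0_ler_poweR => //; rewrite in_itv/= leey andbT//.
exact: le_trans xy.
Qed.

Lemma poweR_le_inv (x y : \bar R) r : 0 < r -> (0 <= x)%E -> (0 <= y)%E ->
  (x `^ r <= y `^ r)%E -> (x <= y)%E.
Proof.
move=> r0 x0 y0 h.
have : ((x `^ r) `^ r^-1 <= (y `^ r) `^ r^-1)%E.
  by apply: le_poweR; rewrite ?invr_ge0 ?(ltW r0) ?poweR_ge0.
by rewrite -!poweRrM divff ?gt_eqF// !poweRe1.
Qed.

Lemma powRK a r : r != 0 -> 0 <= a -> (a `^ r) `^ r^-1 = a.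
Proof. by move=> r0 a0; rewrite -powRrM divff// powRr1. Qed.

Lemma powRKV a r : r != 0 -> 0 <= a -> (a `^ r^-1) `^ r = a.
Proof. by move=> r0 a0; rewrite -powRrM mulVf// powRr1. Qed.

(* Convexity of [u ^ r] at the weights [a / (a + b)] and [b / (a + b)]. *)
Lemma powRD_weighted (a b u v r : R) : 0 < a -> 0 < b -> 0 <= u -> 0 <= v -> 1 <= r ->
  (u + v) `^ r <=
  (a + b) `^ r * (a / (a + b) * (u `^ r / a `^ r) + b / (a + b) * (v `^ r / b `^ r)).
Proof.
move=> a0 b0 u0 v0 r1; have ab0 : 0 < a + b by rewrite addr_gt0.
have w0 : 0 <= a / (a + b) by rewrite divr_ge0// ltW.
have w1 : a / (a + b) <= 1 by rewrite ler_pdivrMr// mul1r lerDl ltW.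
have := @convex_powR R r r1 (Itv01 w0 w1) (u / a) (v / b).
rewrite !inE/= !in_itv/= !andbT !divr_ge0 ?(ltW a0) ?(ltW b0)// => /(_ isT isT).
set cv := conv _ _ _; have -> : cv =
    a / (a + b) * (u / a) + unstable.onem (a / (a + b)) * (v / b) by exact: convRE.
rewrite convRE/=.
have -> : unstable.onem (a / (a + b)) = b / (a + b).
  by rewrite /unstable.onem -{1}(@divff _ (a + b)) ?gt_eqF// -mulrBl addrAC subrr add0r.
have e (c z : R) : 0 < c -> 0 <= z -> (z / c) `^ r = z `^ r / c `^ r.
  move=> c0 z0; rewrite powRM ?invr_ge0 ?(ltW c0)//; congr (_ * _).
  by rewrite -powR_inv1 ?ltW// -powRrM mulN1r powRN.
rewrite !e// => h.
have -> : u + v = (a + b) * (a / (a + b) * (u / a) + b / (a + b) * (v / b)).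
  by field; rewrite !gt_eqF.
rewrite powRM ?(ltW ab0) ?addr_ge0 ?mulr_ge0 ?invr_ge0 ?(ltW a0) ?(ltW b0) ?(ltW ab0)//.
by rewrite ler_wpM2l ?powR_ge0.
Qed.

Lemma sum_powR_le0 (I : eqType) (s : seq I) (x : I -> R) t : 0 < t ->
  (forall i, 0 <= x i) -> \sum_(i <- s) x i `^ t <= 0 -> {in s, forall i, x i = 0}.
Proof.
move=> t0 x0 h i si.
have : \sum_(i <- s) x i `^ t == 0.
  by rewrite eq_le h sumr_ge0// => j _; rewrite powR_ge0.
rewrite psumr_eq0; last by move=> j _; rewrite powR_ge0.
by move=> /allP /(_ _ si) /= /eqP /powR_eq0_eq0.
Qed.

(** The [r]-triangle inequality of the [l^t] quasi-norm, where [a] and [b] bound its [r]-th powers.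
    Since [r <= 1], [(x + y)^r <= x^r + y^r]; since [t / r >= 1], [powRD_weighted] applies, and its
    weights make the two normalized sums at most 1. It divides by [a] and [b], so zero bounds are
    treated apart. *)
Lemma sum_powRD_le (I : eqType) (s : seq I) (x y : I -> R) (a b t r : R) :
  (forall i, 0 <= x i) -> (forall i, 0 <= y i) -> 0 <= a -> 0 <= b ->
  0 < r <= 1 -> r <= t ->
  \sum_(i <- s) x i `^ t <= a `^ (t / r) ->
  \sum_(i <- s) y i `^ t <= b `^ (t / r) ->
  \sum_(i <- s) (x i + y i) `^ t <= (a + b) `^ (t / r).
Proof.
move=> x0 y0 a0 b0 /andP[r0 r1] rt xa yb.
have t0 : 0 < t by rewrite (lt_le_trans r0).
have tr0 : 0 < t / r by rewrite divr_gt0.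
have [aE|an0] := eqVneq a 0.
  move: xa; rewrite aE powR0 ?gt_eqF// add0r => /(sum_powR_le0 t0 x0) xE.
  by rewrite (eq_big_seq (fun i => y i `^ t))// => i /xE ->; rewrite add0r.
have [bE|bn0] := eqVneq b 0.
  move: yb; rewrite bE powR0 ?gt_eqF// addr0 => /(sum_powR_le0 t0 y0) yE.
  by rewrite (eq_big_seq (fun i => x i `^ t))// => i /yE ->; rewrite addr0.
have {an0}a0' : 0 < a by rewrite lt0r an0.
have {bn0}b0' : 0 < b by rewrite lt0r bn0.
pose w := (a + b) `^ (t / r).
have tr z : z `^ t = (z `^ r) `^ (t / r) by rewrite -powRrM mulrC divfK ?gt_eqF.
apply: (@le_trans _ _ (\sum_(i <- s) w *
   (a / (a + b) * (x i `^ t / a `^ (t / r)) + b / (a + b) * (y i `^ t / b `^ (t / r))))).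
  apply: ler_sum => i _; rewrite (tr (x i)) (tr (y i)) (tr (x i + y i)).
  apply: (@le_trans _ _ ((x i `^ r + y i `^ r) `^ (t / r))).
    by rewrite le_powR ?(ltW tr0) ?powR_ge0// le_powRD// r0.
  by apply: powRD_weighted; rewrite ?powR_ge0// ler_pdivlMr// mul1r.
rewrite -mulr_sumr big_split/= -!mulr_sumr -!mulr_suml.
rewrite -[leRHS]mulr1 ler_wpM2l ?powR_ge0//.
rewrite -[leRHS](@divff _ (a + b)) ?gt_eqF ?addr_gt0// mulrDl lerD//.
  by rewrite ger_pMr ?divr_gt0 ?addr_gt0// ler_pdivrMr ?powR_gt0// mul1r.
by rewrite ger_pMr ?divr_gt0 ?addr_gt0// ler_pdivrMr ?powR_gt0// mul1r.
Qed.

(** The ball of radius [D] in [l^q], stated through finite sums so that it passes to coordinatewise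
    limits. The value [-oo] also falls into the supremum branch; the hypothesis [0 < q] excludes
    it. *)
Definition lq_le q x (D : R) : Prop :=
  if q is t%:E then forall n, \sum_(0 <= k < n) x k `^ t <= D `^ t
  else forall k, x k <= D.

Lemma lq_le_mono q x (D E : R) : (0 < q)%E -> 0 <= D -> D <= E ->
  lq_le q x D -> lq_le q x E.
Proof.
case: q => [t| |]//= t0 D0 DE h n; last exact: le_trans DE.
by apply: (le_trans (h n)); rewrite le_powR// -lee_fin ltW.
Qed.

Lemma lq_le_coord q x (D : R) k : (0 < q)%E -> (forall k, 0 <= x k) -> 0 <= D ->
  lq_le q x D -> x k <= D.
Proof.
case: q => [t| |]//= t0 x0 D0 h; rewrite lte_fin in t0.
apply: (powR_le_inv t0) => //; apply: le_trans (h k.+1).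
by rewrite big_nat_recr//= lerDr sumr_ge0// => i _; rewrite powR_ge0.
Qed.

Lemma lq_le_powR q x (D r : R) : (0 < q)%E -> 0 < r -> 0 <= D ->
  (forall k, 0 <= x k) ->
  lq_le q x D -> lq_le (q / r%:E)%E (fun k => x k `^ r) (D `^ r).
Proof.
case: q => [t| |]//= t0 r0 D0 x0 h.
  rewrite inver gt_eqF//= => n.
  have e z : (z `^ r) `^ (t / r) = z `^ t by rewrite -powRrM mulrC divfK ?gt_eqF.
  by rewrite e; under eq_bigr do rewrite e.
rewrite inver gt_eqF// gt0_mulye ?lte_fin ?invr_gt0//= => k.
by rewrite le_powR// ltW.
Qed.

Lemma lq_leZ q x (D a : R) : (0 < q)%E -> 0 <= D -> 0 <= a ->
  (forall k, 0 <= x k) -> lq_le q x D -> lq_le q (fun k => a * x k) (a * D).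
Proof.
case: q => [t| |]//= t0 D0 a0 x0 h n; last by rewrite ler_wpM2l.
rewrite powRM//; under eq_bigr do rewrite powRM//.
by rewrite -mulr_sumr ler_wpM2l ?powR_ge0.
Qed.

(** Minkowski's inequality in [l^(q / r)], where [q / r >= 1], applied to the [r]-th powers. It
    combines the [r]-triangle inequalities of the single levels into one for the whole cost. *)
Lemma lq_leD q x y (a b r : R) : 0 < r -> (r%:E <= q)%E ->
  (forall k, 0 <= x k) -> (forall k, 0 <= y k) -> 0 <= a -> 0 <= b ->
  lq_le q x a -> lq_le q y b ->
  lq_le q (fun k => (x k `^ r + y k `^ r) `^ r^-1) ((a `^ r + b `^ r) `^ r^-1).
Proof.
case: q => [t| |] r0 rt x0 y0 a0 b0 xa yb; last (exfalso; by rewrite leeNy_eq in rt).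
  rewrite lee_fin in rt.
  have e z : (z `^ r) `^ (t / r) = z `^ t by rewrite -powRrM mulrC divfK ?gt_eqF.
  have e' z : (z `^ r^-1) `^ t = z `^ (t / r) by rewrite -powRrM mulrC.
  have ee (z : nat -> R) n : \sum_(0 <= k < n) (z k `^ r) `^ (t / r) =
      \sum_(0 <= k < n) z k `^ t by apply: eq_bigr => k _; exact: e.
  have H n : \sum_(0 <= k < n) (x k `^ r + y k `^ r) `^ (t / r) <=
      (a `^ r + b `^ r) `^ (t / r).
    have := @sum_powRD_le _ (index_iota 0 n) (fun k => x k `^ r) (fun k => y k `^ r)
      (a `^ r) (b `^ r) (t / r) 1.
    rewrite !divr1 ltr01 lexx; apply; rewrite ?powR_ge0//.
    - by move=> i; rewrite powR_ge0.
    - by move=> i; rewrite powR_ge0.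
    - by rewrite ler_pdivlMr// mul1r.
    - by rewrite e ee; exact: xa.
    - by rewrite e ee; exact: yb.
  move=> n; apply: (le_trans _ (le_trans (H n) _)); last by rewrite -e'.
  by apply: ler_sum => k _; rewrite -e'.
move=> k; apply: le_powR; rewrite ?invr_ge0 ?(ltW r0) ?addr_ge0 ?powR_ge0//.
by apply: lerD; apply: le_powR; rewrite ?(ltW r0).
Qed.

Lemma cvg_powR (u : nat -> R) (l r : R) : (forall n, 0 <= u n) -> 0 < r ->
  u n @[n --> \oo] --> l -> u n `^ r @[n --> \oo] --> l `^ r.
Proof.
move=> u0 r0 ul.
have [l0|l0|l0] := ltgtP l 0.
- suff : 0 <= l by rewrite leNgt l0.
  by apply: (ler_cvg_to (cvg_cst 0) ul); apply: nearW.
- suff h : {for l, continuous ((@powR R)^~ r)} by exact: (continuous_cvg _ h ul).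
  have [dl _] := is_derive1_powR r l0.
  by apply: differentiable_continuous; apply/derivable1_diffP.
(* At 0 the power need not be differentiable; there [u n <= e ^ (1 / r)] gives [u n ^ r <= e]. *)
- rewrite l0 in ul *; rewrite powR0 ?gt_eqF//.
  apply/cvgrPdist_le => e e0; near=> n.
  rewrite sub0r normrN ger0_norm ?powR_ge0//.
  rewrite -[leRHS](@powRKV e r _ (ltW e0)) ?gt_eqF//.
  apply: le_powR; [exact: ltW|exact: u0|].
  apply: ltW; near: n.
  have er0 : 0 < e `^ r^-1 by rewrite powR_gt0.
  move/cvgrPdist_lt : ul => /(_ _ er0); apply: filterS => n.
  by rewrite sub0r normrN ger0_norm.
Unshelve. all: by end_near. Qed.

(** Lower semicontinuity of the cost: each inequality in [lq_le] involves finitely many coordinates.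
    The radius varies with [n] because near-optimal representations carry a slack. *)
Lemma lq_le_lim q (x : nat -> nat -> R) y (D : nat -> R) (C : R) : (0 < q)%E ->
  (forall n k, 0 <= x n k) -> (forall n, 0 <= D n) ->
  (forall k, x n k @[n --> \oo] --> y k) -> D n @[n --> \oo] --> C ->
  (forall n, lq_le q (x n) (D n)) -> lq_le q y C.
Proof.
case: q => [t| |]//= t0 x0 D0 xy DC h.
  move=> n; rewrite lte_fin in t0.
  have xl : (\sum_(0 <= k < n) x m k `^ t) @[m --> \oo] -->
      \sum_(0 <= k < n) y k `^ t.
    apply: cvg_big => [|i _]; first exact: add_continuous.
    exact: cvg_powR.
  by apply: (ler_cvg_to xl (cvg_powR D0 t0 DC)); apply: nearW.
by move=> k; apply: (ler_cvg_to (xy k) DC); apply: nearW.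
Qed.

Lemma nneseries_tail_le (f : nat -> R) (e : R) : (forall k, 0 <= f k) ->
  (\sum_(0 <= k <oo) (f k)%:E < +oo)%E -> 0 < e ->
  exists N, forall n, \sum_(N <= k < n) f k <= e.
Proof.
move=> f0 foo e0.
have f0' k : xpredT k -> (0 <= (f k)%:E)%E by rewrite lee_fin.
have e0' : (0%E < e%:E)%E by rewrite lte_fin.
have H := nneseries_tail_cvg foo f0'.
have : \forall N \near \oo, (\sum_(N <= k <oo) (f k)%:E < e%:E)%E.
  have /fine_cvgP[Hfin /cvgr_lt /(_ _ e0)] := H.
  by apply: filterS2 Hfin => N /fineK <- /=; rewrite lte_fin.
move=> [N _ /(_ N (leqnn N)) /= h]; exists N => n.
rewrite -lee_fin -sumEFin; apply: (le_trans _ (ltW h)).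
by apply: nneseries_lim_ge => k _ _; rewrite lee_fin.
Qed.

Lemma powR_sum_le (x : nat -> R) t (s : seq nat) : (forall k, 0 <= x k) -> 0 < t <= 1 ->
  (\sum_(k <- s) x k) `^ t <= \sum_(k <- s) x k `^ t.
Proof.
move=> x0 /andP[t0 t1]; elim: s => [|k s ih].
  by rewrite !big_nil powR0 ?gt_eqF.
rewrite !big_cons (le_trans (le_powRD _ _ _)) ?sumr_ge0// ?t0//.
by rewrite lerD2l.
Qed.

(** Uniform smallness of the tails of the pairing with [beta]: [N] is chosen before [x]. For
    [q = +oo] the tails of [beta] are small; for [1 < q < +oo] Hoelder's inequality is used in the
    form of Young's inequality with a parameter; for [q <= 1] the [l^1] norm is at most the [l^q]
    quasi-norm and [beta] tends to 0. *)
Lemma lq_tail q (beta : nat -> R) (D e : R) : (0 < q)%E -> (forall k, 0 <= beta k) ->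
  beta k @[k --> \oo] --> 0 ->
  ((1 < q)%E -> (\sum_(0 <= k <oo)
     (beta k `^ fine (hoelder_conjugate q))%:E < +oo)%E) ->
  0 <= D -> 0 < e ->
  exists N, forall x, (forall k, 0 <= x k) -> lq_le q x D ->
    forall n, \sum_(N <= k < n) beta k * x k <= e.
Proof.
move=> + b0 blim + D0 e0.
have D10 : 0 < D + 1 by rewrite ltr_wpDl.
have eD0 : 0 < e / (D + 1) by rewrite divr_gt0.
case: q => [t| |]// t0; last first.
  (* The exponent conjugate to [+oo] is 1, so [beta] itself is summable. *)
  move=> /(_ (ltry _)); rewrite hoelder_conjugatey/= => bs.
  have bs' : (\sum_(0 <= k <oo) (beta k)%:E < +oo)%E.
    by under eq_eseriesr do rewrite -[beta _]powRr1//.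
  have [N Ne] := nneseries_tail_le b0 bs' eD0; exists N => x x0 xD n.
  apply: (@le_trans _ _ (\sum_(N <= k < n) beta k * D)).
    by apply: ler_sum => k _; rewrite ler_wpM2l.
  rewrite -mulr_suml (le_trans (ler_wpM2r D0 (Ne n)))//.
  by rewrite mulrAC ler_pdivrMr// ler_pM2l// lerDl.
rewrite lte_fin in t0; rewrite lte_fin; have [t1|t1] := leP t 1; last first.
  move=> /(_ isT); rewrite /hoelder_conjugate/= eqe gt_eqF//=.
  have t10 : 0 < t - 1 by rewrite subr_gt0.
  rewrite inver subr_eq0 gt_eqF//=; set t' := t / (t - 1) => bs.
  have t'0 : 0 < t' by rewrite divr_gt0.
  have tt' : t'^-1 + t^-1 = 1 by rewrite /t'; field; rewrite !gt_eqF.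
  have t'1 : 1 <= t' by rewrite ler_pdivlMr// mul1r gerBl.
  (* Chosen so that [(eta * D)^t <= e / 2]; [D + 1] guards against [D = 0]. The tail of the [beta]
     series is then taken below [(e / 2) * eta^t'], which cancels the factor [eta^(-t')] from
     Young's inequality. *)
  pose eta := (e / 2) `^ t^-1 / (D + 1).
  have eta0 : 0 < eta by rewrite !(divr_gt0, powR_gt0).
  have de : 0 < e / 2 * eta `^ t' by rewrite mulr_gt0 ?divr_gt0 ?powR_gt0//.
  have [N Ne] := nneseries_tail_le (fun k => powR_ge0 (beta k) t') bs de.
  exists N => x x0 xD n.
  apply: (@le_trans _ _ (\sum_(N <= k < n)
      (eta^-1 `^ t' * beta k `^ t' + eta `^ t * x k `^ t))).
    apply: ler_sum => k _.
    have -> : beta k * x k = (eta^-1 * beta k) * (eta * x k) by field; rewrite gt_eqF.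
    apply: (le_trans (conjugate_powR _ _ t'0 t0 tt')).
    - by rewrite mulr_ge0// invr_ge0 ltW.
    - by rewrite mulr_ge0// ltW.
    rewrite -!powRM ?invr_ge0 ?(ltW eta0)//.
    by apply: lerD; rewrite ler_piMr ?powR_ge0// invf_le1// ltW.
  rewrite big_split/= -!mulr_sumr.
  rewrite [leRHS](splitr e) lerD//.
    apply: (le_trans (ler_wpM2l (powR_ge0 _ _) (Ne n))).
    rewrite mulrCA -powRM ?invr_ge0 ?(ltW eta0)// mulVf ?gt_eqF// powR1 mulr1//.
  have xs : \sum_(N <= k < n) x k `^ t <= D `^ t.
    have [Nn|Nn] := leqP N n; last by rewrite big_geq ?powR_ge0// ltnW.
    apply: (le_trans _ (xD n)); rewrite (big_cat_nat (leq0n N) Nn)/= lerDr sumr_ge0// => k _.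
    exact: powR_ge0.
  apply: (le_trans (ler_wpM2l (powR_ge0 _ _) xs)).
  rewrite -powRM// ?(ltW eta0)// -(@powRKV (e / 2) t) ?gt_eqF ?divr_ge0 ?(ltW e0)//.
  apply: le_powR; [exact: ltW|exact: mulr_ge0 (ltW eta0) D0|].
  by rewrite /eta mulrAC ler_pdivrMr// ler_pM2l ?powR_gt0 ?divr_gt0// lerDl.
move=> _; have : \forall k \near \oo, beta k < e / (D + 1).
  by move/cvgrPdist_lt : blim => /(_ _ eD0); apply: filterS => k;
    rewrite sub0r normrN ger0_norm.
move=> [N _ Nb]; exists N => x x0 xD n.
(* Here [t <= 1], so the sum is bounded by the [l^t] quasi-norm of [x]. *)
have xs : \sum_(N <= k < n) x k <= D.
  have [Nn|Nn] := leqP N n; last by rewrite big_geq// ltnW.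
  apply: (powR_le_inv t0) => //; first by rewrite sumr_ge0.
  apply: (le_trans (powR_sum_le _ x0 _)); first by rewrite t0.
  apply: (le_trans _ (xD n)); rewrite (big_cat_nat (leq0n N) Nn)/= lerDr sumr_ge0// => k _.
  exact: powR_ge0.
apply: (@le_trans _ _ (\sum_(N <= k < n) e / (D + 1) * x k)).
  rewrite !big_nat; apply: ler_sum => k /andP[Nk _]; rewrite ler_wpM2r// ltW//.
  exact: Nb.
rewrite -mulr_sumr (le_trans (ler_wpM2l (ltW eD0) xs))//.
by rewrite mulrAC ler_pdivrMr// ler_pM2l// lerDl.
Qed.

End sequence_norms.

(** * Subsequences and compactness *)

Section subsequences.

Lemma increasing_seq_comp (s k : nat -> nat) :
  increasing_seq s -> increasing_seq k -> increasing_seq (s \o k).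
Proof. by move=> si ki m n; exact: etrans (si _ _) (ki _ _). Qed.

Lemma increasing_seq_lt (s : nat -> nat) m n :
  increasing_seq s -> (m < n)%N -> (s m < s n)%N.
Proof. by move=> si mn; rewrite ltnNge -leEnat si -ltnNge. Qed.

Lemma increasing_seq_ge (s : nat -> nat) n : increasing_seq s -> (n <= s n)%N.
Proof.
by move=> si; elim: n => // n ih; apply: leq_ltn_trans ih _; exact: increasing_seq_lt.
Qed.

Lemma increasing_seqS (s : nat -> nat) :
  (forall n, (s n < s n.+1)%N) -> increasing_seq s.
Proof. by move=> h; apply/increasing_seqP => n; rewrite ltEnat/= h. Qed.

Lemma increasing_cvg (s : nat -> nat) : increasing_seq s -> s n @[n --> \oo] --> \oo.
Proof.
move=> si A [N _ NA]; exists N => // n /= Nn; apply: NA => /=.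
by rewrite (leq_trans Nn)// increasing_seq_ge.
Qed.

(** Each property can be achieved by refinement, survives further refinement and ignores initial
    terms. With [sigma i] the composite of the first [i] refinements, the diagonal [n |-> sigma n n]
    is eventually a subsequence of every [sigma i]. *)
Lemma diagonal_subsequence (X : nat -> (nat -> nat) -> Prop) :
  (forall i s, increasing_seq s -> exists2 k, increasing_seq k & X i (s \o k)) ->
  (forall i s k, increasing_seq k -> X i s -> X i (s \o k)) ->
  (forall i s N, X i (fun n => s (n + N)%N) -> X i s) ->
  exists2 s, increasing_seq s & forall i, X i s.
Proof.
move=> Xex Xsub Xtail.
(* Bundling the monotonicity proof lets [choice] provide a total refinement function on which to
   recurse. *)
pose inc := {s : nat -> nat | increasing_seq s}.
have incP (s : inc) : increasing_seq (sval s) by case: s.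
have id_inc : increasing_seq (id : nat -> nat) by [].
have /choice[tau tauP] : forall is_ : nat * inc, exists k : inc,
    X is_.1 (sval is_.2 \o sval k).
  by move=> [i [s si]]; have [k ki Xk] := Xex i s si; exists (exist _ k ki).
have comp_inc (s k : inc) : increasing_seq (sval s \o sval k).
  exact: increasing_seq_comp.
pose mk (s : nat -> nat) (si : increasing_seq s) : inc := exist _ s si.
pose sigma := fix sigma i : inc :=
  if i is i'.+1 then
    mk _ (comp_inc (sigma i') (tau (i', sigma i')))
  else mk id id_inc.
pose t i : nat -> nat := sval (tau (i, sigma i)).
have ti i : increasing_seq (t i) by exact: incP.
have si i : increasing_seq (sval (sigma i)) by exact: incP.
have sS i : sval (sigma i.+1) = sval (sigma i) \o t i by [].
exists (fun n => sval (sigma n) n).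
  apply: increasing_seqS => n; rewrite sS /=; apply: increasing_seq_lt (si n) _.
  exact: increasing_seq_ge.
(* Property [X i] first holds at stage [i.+1], whose last refinement is the one made for [i]; hence
   the shift by [i.+1]. *)
move=> i; apply: (Xtail _ _ i.+1).
(* The composite of the [n] refinements following stage [i.+1]. *)
pose g := fix g n : nat -> nat := if n is n'.+1 then g n' \o t (n' + i.+1)%N else id.
have gi n : increasing_seq (g n) by elim: n => // n ih; exact: increasing_seq_comp.
have gE n : sval (sigma (n + i.+1)%N) = sval (sigma i.+1) \o g n.
  by elim: n => // n ih; rewrite addSn sS ih.
have -> : (fun n => sval (sigma (n + i.+1)%N) (n + i.+1)%N) =
    sval (sigma i.+1) \o (fun n => g n (n + i.+1)%N).
  by apply/funext => n; rewrite gE.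
apply: Xsub; last by rewrite sS; exact: tauP (i, sigma i).
apply: increasing_seqS => n /=; apply: increasing_seq_lt => //.
by rewrite addSn; exact: increasing_seq_ge.
Qed.

End subsequences.

Section metric_compactness.
Context {R : realType} {T : metricType R}.
Implicit Types (A : set T) (u : nat -> T) (l : T).

Lemma cvg_mdistP u l :
  u n @[n --> \oo] --> l <-> mdist l (u n) @[n --> \oo] --> (0 : R).
Proof.
split=> [/cvg_ballP ul|/cvgrPdist_lt ul].
  apply/cvgrPdist_lt => e e0; have := ul e e0; apply: filterS => n.
  by rewrite ballEmdist/= sub0r normrN ger0_norm ?mdist_ge0.
apply/cvg_ballP => e e0; have := ul e e0; apply: filterS => n.
by rewrite ballEmdist/= sub0r normrN ger0_norm ?mdist_ge0.
Qed.

Definition sequentially_compact A := forall u, (forall n, A (u n)) ->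
  exists2 k : nat -> nat, increasing_seq k &
    exists2 l, A l & u (k n) @[n --> \oo] --> l.

(** A cluster point becomes a limit by extracting a subsequence from the real sequence of distances
    to it, which clusters at 0. *)
Lemma compact_sequentially_compact A : compact A -> sequentially_compact A.
Proof.
move=> cA u Au.
have uA : (u @ \oo) A by exists 0%N => // n _; exact: Au.
have [l [Al ul]] := cA _ _ uA.
have : cluster (mdist l (u n) @[n --> \oo]) (0 : R).
  apply/cluster_eventuallyP => e N e0.
  have [] := ul [set u n | n in [set n | (N <= n)%N]] (ball l e) _ (nbhsx_ballx _ _ e0).
    by exists N => // n Nn; exists n.
  move=> _ [[n /= Nn <-]]; rewrite ballEmdist/= => lu; exists n => //.
  by rewrite sub0r normrN ger0_norm ?mdist_ge0// ltW.
by move=> /cluster_eventually_cvg[k ki kl]; exists k => //; exists l => //; apply/cvg_mdistP.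
Qed.

(** Otherwise a greedy choice yields a sequence whose terms are pairwise not [e]-close, so that no
    subsequence of it converges. *)
Lemma sequentially_compact_covering A (e : R) : sequentially_compact A -> 0 < e ->
  exists s : seq T, forall x, A x -> exists2 y, y \in s & ball y e x.
Proof.
move=> sA e0; apply: contrapT => /forallNP h.
have /choice[g gP] : forall s : seq T, exists x, A x /\ forall y, y \in s -> ~ ball y e x.
  move=> s; have /existsNP[x /not_implyP[Ax sx]] := h s; exists x; split=> // y ys yx.
  by apply: sx; exists y.
pose t := fix t n := if n is n'.+1 then g (t n') :: t n' else [::].
have gt m n : (m < n)%N -> g (t m) \in t n.
  elim: n => // n ih; rewrite ltnS leq_eqVlt => /orP[/eqP ->|/ih mn] /=.
    by rewrite inE eqxx.
  by rewrite inE mn orbT.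
have [k ki [l _ /cvg_ballP ul]] := sA (fun n => g (t n)) (fun n => (gP (t n)).1).
have e20 : 0 < e / 2 by rewrite divr_gt0.
have [N _ Nl] := ul _ e20.
have [_] := gP (t (k N.+1)).
move=> /(_ (g (t (k N)))); apply; first exact/gt/increasing_seq_lt.
rewrite [e]splitr; apply: (@ball_triangle _ _ l); last by apply: Nl => /=.
by apply: ball_sym; apply: Nl => /=.
Qed.

Lemma ultra_ball_cover (F : set_system T) (s : seq T) (e : R) : UltraFilter F ->
  F [set x | exists2 y, y \in s & ball y e x] -> exists2 y, y \in s & F (ball y e).
Proof.
move=> UF; elim: s => [|y s ih] Fs.
  have : F set0 by apply: filterS Fs => x [].
  by move/filter_ex => [].
have [Fy|Fy] := in_ultra_setVsetC (ball y e) UF.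
  by exists y; rewrite // inE eqxx.
have [|z zs Fz] := ih; last by exists z; rewrite // inE zs orbT.
apply: filterS (filterI Fs Fy) => x [[z]]; rewrite inE => /orP[/eqP ->//|zs] zx _.
by exists z.
Qed.

(** An ultrafilter on [A] contains arbitrarily small balls centred in [A]; a subsequence of the
    centres converges, and the ultrafilter converges to the same point. *)
Lemma sequentially_compact_compact A : sequentially_compact A -> compact A.
Proof.
move=> sA; rewrite compact_ultra => F UF FA.
have /choice[y yP] : forall n : nat, exists y, A y /\ F (ball y (n.+1%:R^-1)).
  move=> n; have e0 : 0 < n.+1%:R^-1 / 2 :> R by rewrite divr_gt0// invr_gt0.
  have [s sP] := sequentially_compact_covering sA e0.
  (* Half the radius, because the centres of the covering may lie outside [A]: recentring the ball
     at a point of [A] doubles it. *)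
  have [|x _ Fx] := @ultra_ball_cover F s (n.+1%:R^-1 / 2) UF; first by apply: filterS FA; exact: sP.
  have [y [Ay xy]] := filter_ex (filterI FA Fx).
  exists y; split=> //; apply: filterS Fx => z xz.
  by rewrite [n.+1%:R^-1]splitr; apply: ball_triangle xz; exact: ball_sym.
have [k ki [l Al yl]] := sA y (fun n => (yP n).1).
exists l; split => // B /nbhs_ballP[e /= e0 eB].
have e20 : 0 < e / 2 by rewrite divr_gt0.
have /cvg_ballP /(_ _ e20) H1 := yl.
have H2 : \forall n \near \oo, (k n).+1%:R^-1 < e / 2.
  have : \forall n \near \oo, n.+1%:R^-1 < e / 2 := near_infty_natSinv_lt (PosNum e20).
  move=> [N _ NP]; exists N => // n /= Nn; apply: NP => /=.
  by rewrite (leq_trans Nn)// increasing_seq_ge.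
have [n [n1 n2]] := filter_ex (filterI H1 H2).
apply: filterS (yP (k n)).2 => z yz; apply: eB.
rewrite [e]splitr; apply: ball_triangle n1 _.
exact: le_ball (ltW n2) _ yz.
Qed.

End metric_compactness.

(** * Completeness of L^p *)

Section Lp_complete.
Context d (T : measurableType d) (R : realType).
Variables (mu : {measure set T -> \bar R}) (p : R) (p0 : 0 < p).

Let rho : R := Num.min 1 p.

Lemma min1_gt0 : 0 < rho. Proof. by rewrite lt_min ltr01. Qed.

Lemma normc_real (x : R) : normc (x%:C)%C = `|x|.
Proof. by rewrite /= expr0n/= addr0 sqrtr_sqr. Qed.

Lemma normr_Re_le (z : R[i]) : `|complex.Re z| <= normc z.
Proof.
case: z => a b /=; rewrite -sqrtr_sqr ler_wsqrtr// lerDl; exact: sqr_ge0.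
Qed.

Lemma normr_Im_le (z : R[i]) : `|complex.Im z| <= normc z.
Proof.
case: z => a b /=; rewrite -sqrtr_sqr ler_wsqrtr// lerDr; exact: sqr_ge0.
Qed.

Lemma normc_le_ReIm (z : R[i]) : normc z <= `|complex.Re z| + `|complex.Im z|.
Proof.
case: z => a b /=.
rewrite -[leRHS]ger0_norm ?addr_ge0// -[leRHS]sqrtr_sqr ler_wsqrtr//.
rewrite sqrrD !real_normK ?num_real// lerD2r lerDl.
by rewrite mulrn_wge0// mulr_ge0.
Qed.

Lemma cvg_normc (z : nat -> R[i]) (w : R[i]) :
  complex.Re (z n) @[n --> \oo] --> complex.Re w ->
  complex.Im (z n) @[n --> \oo] --> complex.Im w ->
  normc (z n) @[n --> \oo] --> normc w.
Proof.
move=> zr zi; rewrite (_ : (fun n => normc (z n)) = (fun n => Num.sqrt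
   (complex.Re (z n) * complex.Re (z n) + complex.Im (z n) * complex.Im (z n)))); last first.
  by apply/funext => n; case: (z n) => a b /=; rewrite !expr2.
have -> : normc w = Num.sqrt
   (complex.Re w * complex.Re w + complex.Im w * complex.Im w).
  by case: (w) => a b /=; rewrite !expr2.
apply: (@cvg_comp _ _ _ _ Num.sqrt); last exact: sqrt_continuous.
by apply: cvgD; exact: cvgM.
Qed.

Lemma cLnorm_le_powR (f : T -> R[i]) (C : R) : 0 <= C ->
  (cLnorm mu p%:E f <= C%:E)%E <->
  (\int[mu]_x ((normc (f x)) `^ p)%:E <= (C `^ p)%:E)%E.
Proof.
move=> C0; rewrite -cLnorm_powR// -poweR_EFin; split=> h.
  by apply: le_poweR; rewrite ?(ltW p0) ?cLnorm_ge0.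
by apply: (poweR_le_inv p0); rewrite ?cLnorm_ge0.
Qed.

Lemma limn_einf_le (u : (\bar R)^nat) (C : \bar R) :
  (\forall n \near \oo, (u n <= C)%E) -> (limn_einf u <= C)%E.
Proof.
move=> uC; rewrite limn_einf_lim; apply: lime_le; first exact: is_cvg_einfs.
apply: filterS uC => n; apply: le_trans; apply: ereal_inf_lbound.
by exists n => /=.
Qed.

Lemma measurable_fun_einf (F : (T -> \bar R)^nat) :
  (forall n, measurable_fun setT (F n)) ->
  measurable_fun setT (fun x => limn_einf (F^~ x)).
Proof.
move=> mF; rewrite /limn_einf; apply: measurableT_comp => //.
apply: (@measurable_fun_limn_esup _ _ _ _ (fun n x => - F n x)%E) => n.
exact: measurableT_comp.
Qed.

(** Fatou's lemma for the [p]-th powers of the moduli, whose lower limit is [normc (g x) ^ p] almost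
    everywhere. *)
Lemma cLnorm_lim_le (f : nat -> T -> R[i]) (g : T -> R[i]) (C : R) : 0 <= C ->
  (forall n, cmeasurable (f n)) -> cmeasurable g ->
  {ae mu, forall x, normc (f n x) @[n --> \oo] --> normc (g x)} ->
  (\forall n \near \oo, (cLnorm mu p%:E (f n) <= C%:E)%E) -> (cLnorm mu p%:E g <= C%:E)%E.
Proof.
move=> C0 mf mg fg fC; apply/cLnorm_le_powR => //.
pose F n x : \bar R := ((normc (f n x)) `^ p)%:E.
have mF n : measurable_fun setT (F n) by exact: measurable_normc_powR.
have F0 n x : setT x -> (0 <= F n x)%E by move=> _; rewrite lee_fin powR_ge0.
rewrite (_ : integral _ _ _ = \int[mu]_x limn_einf (F^~ x))%E; last first.
  apply: ae_eq_integral => //.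
  - exact: measurable_normc_powR.
  - exact: measurable_fun_einf.
  apply: filterS fg => x fx _; apply/esym.
  have H : F n x @[n --> \oo] --> ((normc (g x)) `^ p)%:E.
    apply: cvg_EFin; first by apply: nearW.
    by apply: cvg_powR => // n; exact: normc_ge0.
  have Hc : cvgn (F^~ x) by apply/cvg_ex; eexists; exact: H.
  by rewrite (is_cvg_limn_einfE Hc); exact/cvg_lim.
apply: (le_trans (fatou mu measurableT mF F0)).
apply: limn_einf_le; apply: filterS fC => n /cLnorm_le_powR; exact.
Qed.

Lemma Lp_norm_sum (I : Type) (s : seq I) (f : I -> Lp mu p0) :
  Lp_norm (\sum_(i <- s) f i) `^ rho <= \sum_(i <- s) Lp_norm (f i) `^ rho.
Proof.
elim: s => [|i s ih]; first by rewrite !big_nil Lp_norm0 powR0 ?gt_eqF ?min1_gt0.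
by rewrite !big_cons (le_trans (Lp_normD _ _))// lerD2l.
Qed.

(** The moduli are embedded in the complex numbers so that [cLnormD] can be iterated on them. *)
Lemma cLnorm_sum_normc (f : nat -> T -> R[i]) n :
  (forall k, cmeasurable (f k)) ->
  (cLnorm mu p%:E (fun x => (\sum_(0 <= k < n) normc (f k x))%:C)%C `^ rho <=
   \sum_(0 <= k < n) cLnorm mu p%:E (f k) `^ rho)%E.
Proof.
move=> mf.
have mreal (h : T -> R) : measurable_fun setT h -> cmeasurable (fun x => (h x)%:C)%C.
  by move=> mh; split.
have msum m : measurable_fun setT (fun x => \sum_(0 <= k < m) normc (f k x)).
  by apply: measurable_sum => k; exact: measurable_normc.
elim: n => [|n ih].
  rewrite big_nil /cLnorm (_ : (fun x => _) = cst 0%E); last first.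
    by apply/funext => x; rewrite big_nil normc_real normr0.
  by rewrite Lnorm0 ?eqe ?gt_eqF// poweR0r// gt_eqF// min1_gt0.
rewrite big_nat_recr//=; apply: (le_trans _ (leeD ih (lexx _))).
have -> : cLnorm mu p%:E (f n) = cLnorm mu p%:E (fun x => (normc (f n x))%:C)%C.
  by apply: eq_Lnorm => x; rewrite normc_real ger0_norm ?normc_ge0.
rewrite (_ : (fun x => _) = (fun x => (\sum_(0 <= k < n) normc (f k x))%:C)%C
   \+ (fun x => (normc (f n x))%:C)%C); last first.
  by apply/funext => x; rewrite big_nat_recr//= rmorphD.
by apply: cLnormD => //; apply: mreal => //; exact: measurable_normc.
Qed.

(** The partial sums of the moduli have [L^p] norms at most [C], so by Fatou's lemma the limit of
    their [p]-th powers is integrable, hence finite almost everywhere. *)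
Lemma ae_bounded_partial_sums (f : nat -> Lp mu p0) :
  (\sum_(0 <= k <oo) (Lp_norm (f k) `^ rho)%:E < +oo)%E ->
  {ae mu, forall x, exists B, forall n, \sum_(0 <= k < n) normc (f k x) <= B}.
Proof.
move=> foo; set K := (\sum_(0 <= k <oo) _)%E in foo.
have K0 : (0 <= K)%E by apply: nneseries_ge0 => k _ _; rewrite lee_fin powR_ge0.
pose C := fine K `^ rho^-1.
have C0 : 0 <= C by exact: powR_ge0.
pose G n x := \sum_(0 <= k < n) normc (f k x).
have mf k : cmeasurable (f k) by exact: Lp_cmeasurable.
have G0 n x : 0 <= G n x by apply: sumr_ge0 => k _; exact: normc_ge0.
have mG n : cmeasurable (fun x => (G n x)%:C)%C.
  split=> //=; apply: measurable_sum => k; exact: measurable_normc.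
have GC n : (cLnorm mu p%:E (fun x => (G n x)%:C)%C <= C%:E)%E.
  have := cLnorm_sum_normc n mf.
  have rho_gt0 := min1_gt0.
  have : (\sum_(0 <= k < n) cLnorm mu p%:E (f k) `^ rho <= (C `^ rho)%:E)%E.
    rewrite powRKV ?gt_eqF ?fine_ge0// fineK ?ge0_fin_numE//.
    under eq_bigr do rewrite -Lp_normE poweR_EFin.
    by apply: nneseries_lim_ge => k _ _; rewrite lee_fin powR_ge0.
  move=> /[swap] /le_trans /[apply]; rewrite -poweR_EFin => h.
  by apply: (poweR_le_inv rho_gt0 _ _ h); rewrite ?cLnorm_ge0.
pose F n x : \bar R := (G n x `^ p)%:E.
have FE n x : F n x = ((normc (G n x)%:C%C) `^ p)%:E by rewrite normc_real ger0_norm.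
have mF n : measurable_fun setT (F n).
  rewrite (_ : F n = fun x => ((normc (G n x)%:C%C) `^ p)%:E); last exact/funext.
  exact: measurable_normc_powR.
have F0 n x : setT x -> (0 <= F n x)%E by move=> _; rewrite lee_fin powR_ge0.
have ndF x : nondecreasing_seq (F^~ x).
  apply/nondecreasing_seqP => n; rewrite lee_fin le_powR ?(ltW p0)//.
  by rewrite /G big_nat_recr//= lerDl normc_ge0.
(* By monotonicity the lower limit is the supremum, which bounds every partial sum. *)
have limF x : limn_einf (F^~ x) = ereal_sup (range (F^~ x)).
  have := ereal_nondecreasing_cvgn (ndF x) => h.
  have Hc : cvgn (F^~ x) by apply/cvg_ex; eexists; exact: h.
  by rewrite (is_cvg_limn_einfE Hc); exact/cvg_lim.
have limF0 x : (0 <= limn_einf (F^~ x))%E.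
  by rewrite limF; apply: (le_trans (F0 0%N x I)); apply: ereal_sup_ubound; exists 0%N.
have : mu.-integrable setT (fun x => limn_einf (F^~ x)).
  apply/integrableP; split; first exact: measurable_fun_einf.
  under eq_integral do rewrite gee0_abs//.
  apply: (le_lt_trans (fatou mu measurableT mF F0)).
  apply: (@le_lt_trans _ _ (C `^ p)%:E); last exact: ltry.
  apply: limn_einf_le; apply: nearW => n.
  under eq_integral do rewrite FE.
  by apply/cLnorm_le_powR.
move=> /(integrable_ae measurableT); apply: filterS => x /(_ I) limfin.
exists (fine (limn_einf (F^~ x)) `^ p^-1) => n.
rewrite -(@powRK _ (\sum_(0 <= k < n) normc (f k x)) p) ?gt_eqF ?G0//.
apply: le_powR; rewrite ?invr_ge0 ?(ltW p0) ?powR_ge0//.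
by rewrite -lee_fin fineK// limF; apply: ereal_sup_ubound; exists n.
Qed.

Lemma Lp_fun0 : {ae mu, forall x, (0 : Lp mu p0) x = 0}.
Proof.
have := scale_LpE 0 (0 : Lp mu p0).
rewrite -[scale_Lp _ _]/(0 *: (0 : Lp mu p0)) scale0r.
by apply: filterS => x ->; rewrite mul0r.
Qed.

Lemma cmeasurableN (h : T -> R[i]) : cmeasurable h -> cmeasurable (fun x => - h x).
Proof.
move=> mh; rewrite (_ : (fun x => _) = fun x => (-1) * h x).
  exact: cmeasurableZ.
by apply/funext => x; rewrite mulN1r.
Qed.

Lemma Lp_funN (f : Lp mu p0) : {ae mu, forall x, (- f : Lp mu p0) x = - f x}.
Proof.
apply: filterS (scale_LpE (-1) f) => x.
by rewrite -[scale_Lp _ _]/(-1 *: (f : Lp mu p0)) scaleN1r => ->; rewrite mulN1r.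
Qed.

Lemma Lp_funB (f g : Lp mu p0) : {ae mu, forall x, (f - g : Lp mu p0) x = f x - g x}.
Proof. by apply: filterS2 (Lp_funD f (- g)) (Lp_funN g) => x -> ->. Qed.

Lemma ae_series (f : nat -> Lp mu p0) :
  {ae mu, forall x, forall n, (series f n : Lp mu p0) x = \sum_(0 <= k < n) f k x}.
Proof.
have H n : {ae mu, forall x, (series f n.+1 : Lp mu p0) x = (series f n : Lp mu p0) x + f n x}.
  by rewrite /series/= big_nat_recr//=; exact: Lp_funD.
have H0 := Lp_fun0.
have /ae_foralln H' := H.
apply: filterS2 H0 H' => x x0 xS; elim=> [|n ih].
  by rewrite /series/= !big_geq.
by rewrite xS ih big_nat_recr.
Qed.

(* Riesz-Fischer: the pointwise sum exists almost everywhere because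
   [sum_k |f_k|] is finite there, and Fatou's lemma bounds its distance to the
   partial sums. *)
Lemma Lp_series_cvg (f : nat -> Lp mu p0) :
  (\sum_(0 <= k <oo) (Lp_norm (f k) `^ rho)%:E < +oo)%E ->
  exists g : Lp mu p0, series f @ \oo --> g.
Proof.
move=> foo.
have rho_gt0 := min1_gt0.
(* An upper limit exists at every point and is measurable; off a null set it is the limit. *)
pose gr x := fine (limn_esup (fun n => (complex.Re ((series f n : Lp mu p0) x))%:E)).
pose gi x := fine (limn_esup (fun n => (complex.Im ((series f n : Lp mu p0) x))%:E)).
pose g x : R[i] := (gr x +i* gi x)%C.
have mlim (h : nat -> T -> R) : (forall n, measurable_fun setT (h n)) ->
    measurable_fun setT (fun x => fine (limn_esup (fun n => (h n x)%:E))).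
  move=> mh; apply: (@measurableT_comp _ _ _ _ _ _ (@fine R)).
    exact: fine_measurable.
  apply: (@measurable_fun_limn_esup _ _ _ _ (fun n x => (h n x)%:E)) => n.
  exact/measurable_EFinP.
have mg : cmeasurable g.
  by split=> /=; apply: mlim => n; have [] := Lp_cmeasurable (series f n).
have fg : {ae mu, forall x,
    complex.Re ((series f n : Lp mu p0) x) @[n --> \oo] --> complex.Re (g x) /\
    complex.Im ((series f n : Lp mu p0) x) @[n --> \oo] --> complex.Im (g x)}.
  apply: filterS2 (ae_bounded_partial_sums foo) (ae_series f) => x [B xB] xS.
  have bcvg (h : nat -> R) : (forall k, `|h k| <= normc (f k x)) -> cvgn (series h).
    move=> hf; apply: normed_cvg; apply: nondecreasing_is_cvgn.
      apply/nondecreasing_seqP => n.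
      change (\sum_(0 <= k < n) `|h k| <= \sum_(0 <= k < n.+1) `|h k|).
      by rewrite big_nat_recr//= lerDl.
    exists B => _ [n _ <-]; apply: (le_trans _ (xB n)).
    by change (\sum_(0 <= k < n) `|h k| <= \sum_(0 <= k < n) normc (f k x));
       apply: ler_sum.
  have lim_esup (h : nat -> R) : cvgn h ->
      h n @[n --> \oo] --> fine (limn_esup (fun n => (h n)%:E)).
    move=> hc; have hE : (h n)%:E @[n --> \oo] --> (limn h)%:E.
      by apply: cvg_EFin; [apply: nearW|exact: hc].
    by have [_ ->] := cvg_limn_einf_sup hE.
  split; apply: lim_esup.
    rewrite (_ : (fun n => _) = series (fun k => complex.Re (f k x))).
      by apply: bcvg => k; exact: normr_Re_le.
    by apply/funext => n; rewrite xS raddf_sum.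
  rewrite (_ : (fun n => _) = series (fun k => complex.Im (f k x))).
    by apply: bcvg => k; exact: normr_Im_le.
  by apply/funext => n; rewrite xS raddf_sum.
(* Used twice: with [n = 0] it puts [g] in [L^p], and with large [n] it gives the convergence. *)
have gC n (C : R) : 0 <= C ->
    (forall m, (n <= m)%N -> \sum_(n <= k < m) Lp_norm (f k) `^ rho <= C) ->
    (cLnorm mu p%:E (fun x => (g x - (series f n : Lp mu p0) x)%R) <= (C `^ rho^-1)%:E)%E.
  move=> C0 nC.
  have mS m : cmeasurable (series f m : Lp mu p0) by exact: Lp_cmeasurable.
  apply: (@cLnorm_lim_le (fun m => (series f m - series f n : Lp mu p0))).
  - exact: powR_ge0.
  - by move=> m; exact: Lp_cmeasurable.
  - by apply: cmeasurableD => //; exact: cmeasurableN.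
  - have /ae_foralln HB : forall m, {ae mu, forall x,
        (series f m - series f n : Lp mu p0) x = (series f m : Lp mu p0) x - (series f n : Lp mu p0) x}.
      by move=> m; exact: Lp_funB.
    apply: filterS2 fg HB => x [fr fi] xB.
    apply: cvg_normc.
      under eq_fun do rewrite xB raddfB /=.
      by rewrite raddfB /=; apply: cvgB => //; exact: cvg_cst.
    under eq_fun do rewrite xB raddfB /=.
    by rewrite raddfB /=; apply: cvgB => //; exact: cvg_cst.
  exists n => // m /= nm.
  rewrite -[cLnorm _ _ _]Lp_normE lee_fin.
  apply: (powR_le_inv rho_gt0); rewrite ?Lp_norm_ge0 ?powR_ge0//.
  rewrite powRKV ?gt_eqF//; apply: (le_trans _ (nC m nm)).
  have -> : series f m - series f n = \sum_(n <= k < m) f k.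
    by rewrite sub_series_geq.
  exact: Lp_norm_sum.
have K0 k : 0 <= Lp_norm (f k) `^ rho by exact: powR_ge0.
have nn n N : (N <= n)%N -> \sum_(N <= k < n) Lp_norm (f k) `^ rho <=
    fine (\sum_(0 <= k <oo) (Lp_norm (f k) `^ rho)%:E)%E.
  move=> Nn; rewrite -lee_fin fineK; last first.
    by rewrite ge0_fin_numE// nneseries_ge0// => k _ _; rewrite lee_fin.
  apply: (@le_trans _ _ (\sum_(0 <= k < n) (Lp_norm (f k) `^ rho)%:E)%E).
    by rewrite sumEFin lee_fin (big_cat_nat (leq0n N) Nn)/= lerDr sumr_ge0.
  by apply: nneseries_lim_ge => k _ _; rewrite lee_fin.
have gfin : (cLnorm mu p%:E g < +oo)%E.
  have {}nn n := nn n 0%N (leq0n n).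
  have := gC 0%N _ _ (fun n _ => nn n).
  rewrite (_ : (fun x => _) = (fun x => g x - (0 : Lp mu p0) x)); last first.
    by apply/funext => x; rewrite /series/= big_geq.
  move=> /(_ (le_trans _ (nn 0%N))); rewrite big_geq// => /(_ (lexx _)) h.
  apply: (@le_lt_trans _ _ (cLnorm mu p%:E (fun x => g x - (0 : Lp mu p0) x))).
    rewrite (@cLnorm_ae_eq _ _ _ mu g (fun x => g x - (0 : Lp mu p0) x)%R p)//.
      by apply: cmeasurableD => //; apply: cmeasurableN; exact: Lp_cmeasurable.
    by apply: filterS Lp_fun0 => x ->; rewrite subr0.
  exact: le_lt_trans h (ltry _).
have gL : g \in cLfun_pred mu p0 by apply/cLfunP.
exists (\pi_(Lp mu p0) (MkLfunC gL))%qT.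
apply/cvg_mdistP/cvgrPdist_le => e e0.
have [N NE] := nneseries_tail_le K0 foo e0.
exists N => // n /= Nn.
rewrite sub0r normrN ger0_norm ?mdist_ge0//.
have : (cLnorm mu p%:E (fun x => (g x - (series f n : Lp mu p0) x)%R) <= (e `^ rho^-1)%:E)%E.
  apply: gC; first exact: ltW.
  move=> m nm; apply: (le_trans _ (NE m)).
  by rewrite (big_cat_nat Nn nm)/= lerDr sumr_ge0.
set gg := (X in mdist X _).
have -> : cLnorm mu p%:E (fun x => g x - (series f n : Lp mu p0) x) =
    cLnorm mu p%:E (gg - series f n : Lp mu p0).
  apply: cLnorm_ae_eq => //.
  - by apply: cmeasurableD => //; apply: cmeasurableN; exact: Lp_cmeasurable.
  - exact: Lp_cmeasurable.
  by apply: filterS2 (Lp_funB gg (series f n)) (Lp_fun_pi (MkLfunC gL)) => x -> ->.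
rewrite -Lp_normE lee_fin => /(le_powR (ltW rho_gt0) (Lp_norm_ge0 _)).
by rewrite powRKV ?gt_eqF// ltW.
Qed.

End Lp_complete.

(** * Size of atoms and levels *)

Section atoms_size.
Context d (T : measurableType d) (R : realType).
Variables (mu : {measure set T -> \bar R}) (p : R) (p0 : 0 < p).
Implicit Types (f : Lp mu p0) (Q : set T) (P : nat -> {fset set T}).

Lemma Lp_norm_le_powR f (C : R) : 0 <= C ->
  (\int[mu]_x ((normc (f x)) `^ p)%:E <= (C `^ p)%:E)%E <-> Lp_norm f <= C.
Proof. by move=> C0; rewrite -cLnorm_le_powR// -Lp_normE lee_fin. Qed.

Lemma Lp_norm_powRE f : ((Lp_norm f `^ p)%:E = \int[mu]_x ((normc (f x)) `^ p)%:E)%E.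
Proof. by rewrite -cLnorm_powR// -poweR_EFin Lp_normE. Qed.

Lemma integral_support Q f : measurable Q -> {ae mu, forall x, ~ Q x -> f x = 0} ->
  (\int[mu]_x ((normc (f x)) `^ p)%:E = \int[mu]_(x in Q) ((normc (f x)) `^ p)%:E)%E.
Proof.
move=> mQ fQ; rewrite [RHS]integral_mkcond; apply: ae_eq_integral => //.
- by apply: measurable_normc_powR; exact: Lp_cmeasurable.
- apply/(measurable_restrictT _ mQ); apply: measurable_funTS.
  by apply: measurable_normc_powR; exact: Lp_cmeasurable.
apply: filterS fQ => x fx _; rewrite patchE; case: ifPn => // /negP.
by rewrite in_setE => /fx ->; rewrite Normc.normc0 powR0 ?gt_eqF.
Qed.

(** Hoelder's inequality on [Q] gives [|f|_p <= |f|_(pu) |Q|^(1 / (u' p))], and this power of [|Q|]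
    cancels the one in (A4). The endpoints [u = +oo] and [u = 1] are treated separately. *)
Lemma Lp_norm_atom (s : R) (u : \bar R) Q f : (1 <= u)%E ->
  measurable Q -> (0 < mu Q)%E -> (mu Q < +oo)%E ->
  {ae mu, forall x, ~ Q x -> f x = 0} ->
  (Lp_enorm (p%:E * u) f <=
    (fine (mu Q) `^ (s - fine (hoelder_conjugate u * p%:E)^-1%E))%:E)%E ->
  Lp_norm f <= fine (mu Q) `^ s.
Proof.
move=> u1 mQ Q0 Qoo fQ.
have Qr : (fine (mu Q))%:E = mu Q by rewrite fineK// ge0_fin_numE.
set a := fine (mu Q) in Qr *.
have a0 : 0 < a by rewrite -lte_fin Qr.
have mf := Lp_cmeasurable f.
have ap (r : R) : (a `^ r) `^ p = a `^ (r * p) by rewrite -powRrM.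
case: u u1 => [r| |]//; last first.
  move=> _; rewrite hoelder_conjugatey mul1e inver gt_eqF//= gt0_muley ?lte_fin//.
  (* The norm of exponent [+oo] is the essential supremum when the space has positive measure, which
     [0 < mu Q] ensures. *)
  rewrite /Lp_enorm /cLnorm unlock ifT; last first.
    by apply: (lt_le_trans Q0); rewrite le_measure ?inE.
  move=> fC; apply/Lp_norm_le_powR; first exact: powR_ge0.
  rewrite (integral_support mQ)// ap.
  have -> : a `^ (s * p) = (a `^ (s - p^-1)) `^ p * a.
    rewrite ap -{3}(powRr1 (ltW a0)) -powRD ?(gt_eqF a0) ?implybT//.
    by congr (_ `^ _); field; rewrite gt_eqF.
  rewrite EFinM Qr -integral_cst//.
  apply: ae_ge0_le_integral => //.
  - by move=> x _; rewrite lee_fin powR_ge0.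
  - by apply: measurable_funTS; exact: measurable_normc_powR.
  - by move=> x _; rewrite lee_fin powR_ge0.
  have /ess_supP := fC.
  apply: filterS => x /=; rewrite lee_fin ger0_norm ?normc_ge0// => fx _.
  by rewrite lee_fin le_powR ?(ltW p0) ?normc_ge0.
rewrite lee_fin le_eqVlt => /predU1P[<-|r1].
  rewrite hoelder_conjugate1 mule1 gt0_mulye ?lte_fin// invey/= subr0.
  by rewrite /Lp_enorm -Lp_normE lee_fin.
have r0 : 0 < r by rewrite (lt_trans ltr01).
have r10 : 0 < r - 1 by rewrite subr_gt0.
rewrite /hoelder_conjugate/= eqe gt_eqF//= inver subr_eq0 gt_eqF//=.
pose r' := r / (r - 1); rewrite -/r'.
have r'0 : 0 < r' by rewrite divr_gt0.
rewrite inver mulf_eq0 !gt_eqF//=.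
rewrite -EFinM /Lp_enorm => fC.
apply/Lp_norm_le_powR; first exact: powR_ge0.
rewrite (integral_support mQ)// ap integral_mkcond.
pose F x := normc (f x) `^ p.
have mF : measurable_fun setT F.
  apply: (@measurableT_comp _ _ _ _ _ _ (@powR R ^~ p)) => //.
  exact: measurable_normc.
have mI : measurable_fun setT (\1_Q : T -> R) by exact: measurable_indic.
have rr' : r^-1 + r'^-1 = 1 by rewrite /r'; field; rewrite !gt_eqF.
(* Applied to [|f|^p] and the indicator of [Q]; the [L^r] norm of [|f|^p] is the [p]-th power of the
   [L^(pr)] norm of [f]. *)
have := hoelder mu mF mI r0 r'0 rr'.
rewrite Lnorm1.
have -> : (\int[mu]_x `|((F \* \1_Q) x)%:E| =
    \int[mu]_x ((fun x => ((normc (f x)) `^ p)%:E) \_ Q) x)%E.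
  apply: eq_integral => x _; rewrite patchE /= indicE; case: ifP => _.
    by rewrite mulr1 ger0_norm ?powR_ge0.
  by rewrite mulr0 normr0.
move=> /le_trans; apply.
have -> : (a `^ (s * p) = (a `^ (s - (r' * p)^-1)) `^ p * a `^ r'^-1).
  rewrite ap -powRD ?(gt_eqF a0) ?implybT//.
  by congr (_ `^ _); field; rewrite !gt_eqF.
rewrite [leRHS]EFinM; apply: lee_pmul; rewrite ?Lnorm_ge0//.
  have -> : (Lnorm mu r%:E (EFin \o F) = cLnorm mu (p * r)%:E f `^ p)%E.
    rewrite /cLnorm unlock -poweRrM invfM mulrAC mulVf ?gt_eqF// mul1r.
    congr (_ `^ _)%E; apply: eq_integral => x _ /=.
    by rewrite !ger0_norm ?powR_ge0 ?normc_ge0// ?poweR_EFin -?powRrM.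
  by rewrite -poweR_EFin; apply: le_poweR; rewrite ?(ltW p0) ?cLnorm_ge0.
rewrite unlock (_ : integral _ _ _ = mu Q); first by rewrite -poweR_EFin Qr.
transitivity (\int[mu]_x (\1_Q x)%:E)%E; last by rewrite integral_indic// setIT.
apply: eq_integral => x _ /=; rewrite ger0_norm// ?poweR_EFin indicE.
by case: (x \in Q); rewrite ?powR1 ?powR0 ?gt_eqF.
Qed.

Lemma Lp_fun_sum (I : Type) (r : seq I) (F : I -> Lp mu p0) :
  {ae mu, forall x, (\sum_(i <- r) F i : Lp mu p0) x = \sum_(i <- r) F i x}.
Proof.
elim: r => [|i r ih].
  by rewrite big_nil; apply: filterS (Lp_fun0 mu p0) => x ->; rewrite big_nil.
rewrite big_cons; apply: filterS2 ih (Lp_funD (F i) (\sum_(j <- r) F j)) => x xE ->.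
by rewrite xE big_cons.
Qed.

Lemma Lp_funZ (a : R[i]) f : {ae mu, forall x, (a *: f : Lp mu p0) x = a * f x}.
Proof. exact: scale_LpE. Qed.

Lemma normc_sum (I : Type) (r : seq I) (F : I -> R[i]) :
  normc (\sum_(i <- r) F i) <= \sum_(i <- r) normc (F i).
Proof.
elim: r => [|i r ih]; first by rewrite !big_nil Normc.normc0.
by rewrite !big_cons (le_trans (le_normcD _ _))// lerD2l.
Qed.

(** At most [M] terms are nonzero and each is at most [Z^(1 / p)]. The constant [M^p] is crude but
    treats all [p > 0] alike. *)
Lemma sum_overlap_powR (I : eqType) (r : seq I) (A : pred I) (z : I -> R) (M : nat) :
  (forall i, 0 <= z i) -> (forall i, ~~ A i -> z i = 0) -> (count A r <= M)%N ->
  (\sum_(i <- r) z i) `^ p <= M%:R `^ p * \sum_(i <- r) z i `^ p.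
Proof.
move=> z0 zA AM.
pose Z := \sum_(i <- r) z i `^ p.
have Z0 : 0 <= Z by apply: sumr_ge0 => i _; exact: powR_ge0.
rewrite -[X in _ * X](@powRKV _ Z p) ?gt_eqF// -powRM ?powR_ge0//.
apply: le_powR; [exact: ltW|exact: sumr_ge0|].
apply: (@le_trans _ _ (\sum_(i <- r) (A i)%:R * Z `^ p^-1)).
  rewrite !big_seq; apply: ler_sum => i ir.
  have [Ai|/zA ->] := boolP (A i); last by rewrite mul0r.
  rewrite mul1r -(@powRK _ (z i) p) ?gt_eqF//.
  apply: le_powR; rewrite ?invr_ge0 ?(ltW p0) ?powR_ge0//.
  by rewrite /Z (big_rem i)//= lerDl sumr_ge0// => j _; exact: powR_ge0.
rewrite -mulr_suml ler_wpM2r ?powR_ge0//.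
rewrite (_ : \sum_(i <- r) _ = (count A r)%:R) ?ler_nat//.
by elim: (r) => [|i r' ih]; rewrite ?big_nil// big_cons ih /= natrD.
Qed.

Lemma le_mesh P k Q : grid mu P -> (mu setT < +oo)%E -> Q \in P k ->
  fine (mu Q) <= mesh mu P k.
Proof.
move=> [gP _ _] Too QP; apply: ub_le_sup; last by exists Q.
exists (fine (mu setT)) => _ [Q' /= /gP[mQ' _] <-].
have h : (mu Q' <= mu setT)%E by rewrite le_measure ?inE.
by apply: fine_le => //; rewrite ge0_fin_numE// (le_lt_trans h).
Qed.

Lemma mesh_ge0 P k : 0 <= mesh mu P k.
Proof.
rewrite /mesh; set E := [set _ | _ in _].
have [[[x Ex] ubE]|/sup_out ->//] := pselect (has_sup E).
by apply: (le_trans _ (ub_le_sup ubE Ex)); case: Ex => Q _ <-; rewrite fine_ge0.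
Qed.

(** By (G1) at most [M] terms of the level are nonzero at almost every point. Integrating
    [sum_overlap_powR] separates the cells, and each atom contributes at most [mesh^s]. *)
Lemma Lp_norm_level P (s : R) (M : nat) (k : nat) (c : set T -> R[i])
    (a : set T -> Lp mu p0) : 0 < s ->
  grid mu P -> (mu setT < +oo)%E ->
  (forall k Q, Q \in P k ->
    (#|` [fset Q' in P k | (Q' `&` Q)%classic != set0]%fset | <= M)%N) ->
  (forall Q, Q \in P k -> {ae mu, forall x, ~ Q x -> a Q x = 0}) ->
  (forall Q, Q \in P k -> Lp_norm (a Q) <= fine (mu Q) `^ s) ->
  Lp_norm (level_sum P c a k) <=
    M%:R * mesh mu P k `^ s * (\sum_(Q <- P k) normc (c Q) `^ p) `^ p^-1.
Proof.
move=> s0 gP Too PM aQ aC.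
have S0 : 0 <= \sum_(Q <- P k) normc (c Q) `^ p.
  by apply: sumr_ge0 => Q _; exact: powR_ge0.
have m0 := mesh_ge0 P k.
apply/Lp_norm_le_powR; first by rewrite !mulr_ge0// powR_ge0.
have mc Q : cmeasurable (c Q *: a Q : Lp mu p0) by exact: Lp_cmeasurable.
pose F x := \sum_(Q <- P k) normc ((c Q *: a Q : Lp mu p0) x) `^ p.
have F0 x : 0 <= F x by apply: sumr_ge0 => Q _; exact: powR_ge0.
have mF : measurable_fun setT F.
  apply: measurable_sum => Q.
  apply: (@measurableT_comp _ _ _ _ _ _ (@powR R ^~ p)) => //.
  exact: measurable_normc.
apply: (@le_trans _ _ (\int[mu]_x (M%:R `^ p * F x)%:E)%E).
  apply: ae_ge0_le_integral => //.
  - by move=> x _; rewrite lee_fin powR_ge0.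
  - by apply: measurable_normc_powR; exact: Lp_cmeasurable.
  - by move=> x _; rewrite lee_fin mulr_ge0 ?powR_ge0.
  - by apply/measurable_EFinP; exact: measurable_funM.
  (* One null set for all cells of the level: indexing them by naturals makes [ae_foralln]
     applicable. *)
  have HZ : {ae mu, forall x, forall Q, Q \in P k -> ~ Q x -> (c Q *: a Q : Lp mu p0) x = 0}.
    have : forall n, {ae mu, forall x, let Q := nth set0 (P k) n in
       Q \in P k -> ~ Q x -> (c Q *: a Q : Lp mu p0) x = 0}.
      move=> n /=; set Q := nth _ _ _; have [QP|QP] := boolP (Q \in P k).
        apply: filterS2 (aQ Q QP) (Lp_funZ (c Q) (a Q)) => x xQ xE _ /xQ.
        by rewrite xE => ->; rewrite mulr0.
      by apply: nearW => x.
    move/ae_foralln; apply: filterS => x xP Q QP.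
    by have := xP (index Q (P k)); rewrite /= nth_index//; exact.
  apply: filterS2 HZ (Lp_fun_sum (P k) (fun Q => c Q *: a Q)) => x xP xE _.
  rewrite lee_fin /level_sum xE.
  apply: (le_trans (le_powR (ltW p0) (normc_ge0 _) (normc_sum _ _))).
  pose A Q := (Q \in P k) && (x \in Q).
  (* All cells containing [x] meet any one of them, so (G1) for that cell bounds their number. *)
  have AM : (count A (P k) <= M)%N.
    have [/hasP[Q0 Q0P /andP[_ Q0x]]|] := boolP (has A (P k)); last first.
      by rewrite has_count -leqNgt leqn0 => /eqP ->.
    apply: (leq_trans _ (PM k Q0 Q0P)).
    rewrite -size_filter; apply: uniq_leq_size; first by rewrite filter_uniq ?fset_uniq.
    move=> Q; rewrite mem_filter => /andP[/andP[QP Qx] _].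
    rewrite !inE/= QP /=; apply/set0P; exists x; split; exact: set_mem.
  (* Extended by zero because [sum_overlap_powR] asks for vanishing at every index outside [A]. *)
  pose z Q := if Q \in P k then normc ((c Q *: a Q : Lp mu p0) x) else 0.
  rewrite (eq_big_seq z); last by move=> Q QP; rewrite /z QP.
  rewrite /F (@eq_big_seq _ _ _ _ (P k) (fun Q => normc ((c Q *: a Q : Lp mu p0) x) `^ p) (fun Q => z Q `^ p)); last first.
    by move=> Q QP; rewrite /z QP.
  apply: (@sum_overlap_powR _ _ A) => //.
    by move=> Q; rewrite /z; case: ifP => // _; exact: normc_ge0.
  move=> Q; rewrite /A /z; case: ifP => //= QP Qx; rewrite xP ?Normc.normc0//.
  by move=> /mem_set; apply/negP.
under eq_integral do rewrite EFinM.
rewrite ge0_integralZl ?lee_fin ?powR_ge0//; last 2 first.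
- exact/measurable_EFinP.
- by move=> x _; rewrite lee_fin.
under eq_integral do rewrite -sumEFin.
rewrite ge0_integral_sum//; last 2 first.
- by move=> Q; exact: measurable_normc_powR.
- by move=> Q x _; rewrite lee_fin powR_ge0.
rewrite -mulrA powRM ?mulr_ge0 ?powR_ge0// EFinM lee_wpmul2l ?lee_fin ?powR_ge0//.
rewrite powRM ?powR_ge0// powRKV ?gt_eqF//.
under eq_bigr do rewrite -Lp_norm_powRE.
rewrite sumEFin lee_fin mulr_sumr big_seq [leRHS]big_seq; apply: ler_sum => Q QP.
rewrite Lp_normZ powRM ?normc_ge0 ?Lp_norm_ge0// mulrC ler_wpM2r ?powR_ge0//.
apply: le_powR; rewrite ?(ltW p0) ?Lp_norm_ge0//.
apply: (le_trans (aC Q QP)); apply: le_powR; rewrite ?(ltW s0) ?fine_ge0//.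
exact: le_mesh.
Qed.

End atoms_size.

(** * Bounded functionals *)

Section dual_separation.
Context d (T : measurableType d) (R : realType).
Variables (mu : {finite_measure set T -> \bar R}) (p : R) (p0 : 0 < p).
Implicit Types (f g : Lp mu p0) (E : set T).

Let M := fine (mu setT).

Let MT : (M%:E = mu setT)%E.
Proof. by rewrite /M fineK// fin_num_measure. Qed.

(* If [t > e] then [t = t ^ p * t ^ (1 - p) <= e ^ (1 - p) * t ^ p]. *)
Lemma le_eps_powR (e t : R) : 1 <= p -> 0 < e -> 0 <= t ->
  t <= e + e `^ (1 - p) * t `^ p.
Proof.
move=> p1 e0 t0; have [te|et] := leP t e.
  by rewrite (le_trans te)// lerDl mulr_ge0 ?powR_ge0.
have t0' : 0 < t by rewrite (lt_trans e0).
apply: (@le_trans _ _ (e `^ (1 - p) * t `^ p)); last by rewrite lerDr ltW.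
have -> : e `^ (1 - p) = (e `^ (p - 1))^-1 by rewrite -powRN opprB.
rewrite mulrC ler_pdivlMr ?powR_gt0//.
rewrite -(mulr_powRB1 t0 p0) ler_wpM2l// le_powR ?subr_ge0// ltW//.
Qed.

(** The integral of [le_eps_powR]. The parameter [e] splits the bound into a part small with [e] and
    a part small with the [L^p] norm, which is the form continuity at 0 requires. *)
Lemma le_integral_normc f (e : R) : 1 <= p -> 0 < e ->
  (\int[mu]_x (normc (f x))%:E <= (e * M + e `^ (1 - p) * Lp_norm f `^ p)%:E)%E.
Proof.
move=> p1 e0.
have mN := measurable_normc_powR p (Lp_cmeasurable f).
apply: (@le_trans _ _ (\int[mu]_x (e%:E + (e `^ (1 - p))%:E * ((normc (f x)) `^ p)%:E))%E).
  apply: ge0_le_integral => //.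
  - by move=> x _; rewrite lee_fin normc_ge0.
  - by apply/measurable_EFinP; apply: measurable_normc; exact: Lp_cmeasurable.
  - by apply: emeasurable_funD => //; exact: measurable_funeM.
  by move=> x _; rewrite lee_fin le_eps_powR ?normc_ge0.
rewrite ge0_integralD//; last 3 first.
- by move=> x _; rewrite lee_fin ltW.
- by move=> x _; rewrite lee_fin mulr_ge0 ?powR_ge0.
- exact: measurable_funeM.
rewrite EFinD 2!EFinM; apply: leeD.
  by rewrite MT integral_cst.
rewrite ge0_integralZl ?lee_fin ?powR_ge0//; last first.
  by move=> x _; rewrite lee_fin powR_ge0.
by rewrite -Lp_norm_powRE.
Qed.

Let proj_le f (h : R[i] -> R) E (e : R) : 1 <= p -> 0 < e -> measurable E ->
  (forall z, `|h z| <= normc z) -> measurable_fun setT (h \o f) ->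
  (\int[mu]_(x in E) `|(h (f x))%:E| <= (e * M + e `^ (1 - p) * Lp_norm f `^ p)%:E)%E.
Proof.
move=> p1 e0 mE hle mh; apply: (le_trans _ (le_integral_normc f p1 e0)).
apply: (@le_trans _ _ (\int[mu]_x `|(h (f x))%:E|)%E).
  apply: ge0_subset_integral => //.
  by apply: measurableT_comp => //; exact/measurable_EFinP.
apply: ge0_le_integral => //.
- by apply: measurableT_comp => //; exact/measurable_EFinP.
- by apply/measurable_EFinP; apply: measurable_normc; exact: Lp_cmeasurable.
by move=> x _; rewrite lee_fin hle.
Qed.

Let proj_integrable f (h : R[i] -> R) E : 1 <= p -> measurable E ->
  (forall z, `|h z| <= normc z) -> measurable_fun setT (h \o f) ->
  mu.-integrable E (EFin \o (h \o f)).
Proof.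
move=> p1 mE hle mh; apply/integrableP; split.
  by apply/measurable_EFinP; exact: measurable_funTS.
exact: le_lt_trans (proj_le p1 ltr01 mE hle mh) (ltry _).
Qed.

Lemma Re_integrable f E : 1 <= p -> measurable E ->
  mu.-integrable E (fun x => (complex.Re (f x))%:E).
Proof.
move=> p1 mE; have [mr _] := Lp_cmeasurable f.
exact: (@proj_integrable f (@complex.Re R) E p1 mE (@normr_Re_le R) mr).
Qed.

Lemma Im_integrable f E : 1 <= p -> measurable E ->
  mu.-integrable E (fun x => (complex.Im (f x))%:E).
Proof.
move=> p1 mE; have [_ mi] := Lp_cmeasurable f.
exact: (@proj_integrable f (@complex.Im R) E p1 mE (@normr_Im_le R) mi).
Qed.

Definition integral_functional E (f : Lp mu p0) : R[i]^o :=
  (Rintegral mu E (fun x => complex.Re (f x)) +i*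
   Rintegral mu E (fun x => complex.Im (f x)))%C.

Lemma integral_functional_linear E : 1 <= p -> measurable E ->
  linear (integral_functional E).
Proof.
move=> p1 mE.
suff H (a b : R) (f g : Lp mu p0) : integral_functional E ((a +i* b)%C *: f + g) =
    ((a +i* b)%C : R[i]) *: integral_functional E f + integral_functional E g.
  by move=> [a b] f g; exact: H.
have re (h : Lp mu p0) := Re_integrable h p1 mE.
have im (h : Lp mu p0) := Im_integrable h p1 mE.
have rez c (h : Lp mu p0) : mu.-integrable E (EFin \o (fun x => c * complex.Re (h x))).
  exact: (integrableZl mE c (re h)).
have imz c (h : Lp mu p0) : mu.-integrable E (EFin \o (fun x => c * complex.Im (h x))).
  exact: (integrableZl mE c (im h)).
have ae : {ae mu, forall x, ((a +i* b)%C *: f + g : Lp mu p0) x = (a +i* b)%C * f x + g x}.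
  by apply: filterS2 (Lp_funD ((a +i* b)%C *: f) g) (Lp_funZ (a +i* b)%C f) => x -> ->.
have R1 : Rintegral mu E (fun x => complex.Re (((a +i* b)%C *: f + g : Lp mu p0) x)) =
    Rintegral mu E (fun x => (a * complex.Re (f x) - b * complex.Im (f x)) + complex.Re (g x)).
  congr fine; apply: ae_eq_integral => //.
  - by have /integrableP[] := re ((a +i* b)%C *: f + g).
  - apply/measurable_EFinP; apply: measurable_funTS.
    have [? ?] := Lp_cmeasurable f; have [? ?] := Lp_cmeasurable g.
    by apply: measurable_funD => //; apply: measurable_funB; exact: measurable_funM.
  by apply: filterS ae => x -> _; case: (f x) => ? ?; case: (g x).
have I1 : Rintegral mu E (fun x => complex.Im (((a +i* b)%C *: f + g : Lp mu p0) x)) =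
    Rintegral mu E (fun x => (a * complex.Im (f x) + b * complex.Re (f x)) + complex.Im (g x)).
  congr fine; apply: ae_eq_integral => //.
  - by have /integrableP[] := im ((a +i* b)%C *: f + g).
  - apply/measurable_EFinP; apply: measurable_funTS.
    have [? ?] := Lp_cmeasurable f; have [? ?] := Lp_cmeasurable g.
    by apply: measurable_funD => //; apply: measurable_funD; exact: measurable_funM.
  by apply: filterS ae => x -> _; case: (f x) => ? ?; case: (g x).
rewrite /integral_functional R1 I1.
rewrite (RintegralD mE (f1 := fun x => a * complex.Re (f x) - b * complex.Im (f x)));
  [|exact: (integrableB mE (rez a f) (imz b f))|exact: re].
rewrite (RintegralD mE (f1 := fun x => a * complex.Im (f x) + b * complex.Re (f x)));
  [|exact: (integrableD mE (imz a f) (rez b f))|exact: im].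
rewrite (RintegralB mE (rez a f) (imz b f)) (RintegralD mE (imz a f) (rez b f)).
rewrite !(RintegralZl _ mE (re f)) !(RintegralZl _ mE (im f)).
by apply/eqP; rewrite eq_complex/= !eqxx.
Qed.

Lemma integral_functional_le E f (e : R) : 1 <= p -> 0 < e -> measurable E ->
  normc (integral_functional E f) <= 2 * (e * M + e `^ (1 - p) * Lp_norm f `^ p).
Proof.
move=> p1 e0 mE; rewrite (le_trans (normc_le_ReIm _))//= mulr_natl mulr2n.
have [mr mi] := Lp_cmeasurable f.
have bound (h : R[i] -> R) : (forall z, `|h z| <= normc z) -> measurable_fun setT (h \o f) ->
    `|Rintegral mu E (h \o f)| <= e * M + e `^ (1 - p) * Lp_norm f `^ p.
  move=> hle mh; have ih := proj_integrable p1 mE hle mh.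
  rewrite (le_trans (le_normr_Rintegral mE ih))//.
  rewrite -lee_fin /Rintegral fineK; first exact: (proj_le p1 e0 mE hle mh).
  exact: (integrable_fin_num mE (integrable_abse ih)).
by apply: lerD; apply: bound => //; [exact: normr_Re_le|exact: normr_Im_le].
Qed.

Lemma gt0_complexE (z : R[i]) : 0 < z -> z = (complex.Re z)%:C%C /\ 0 < complex.Re z.
Proof.
case: z => a b; rewrite ltcE/= => /andP[/eqP b0 a0].
by rewrite {}b0; split.
Qed.

Lemma normcE (z : R[i]) : `|z| = (normc z)%:C%C.
Proof. by []. Qed.

Lemma integral_functional_continuous E : 1 <= p -> measurable E ->
  continuous (integral_functional E).
Proof.
move=> p1 mE f.
have FF : Filter (nbhs f) by exact: nbhs_filter.
apply/(@cvgrPdist_le _ _ _ (nbhs f) FF) => z /gt0_complexE[-> e0].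
set e := complex.Re z in e0 *.
have M0 : 0 <= M by rewrite fine_ge0.
(* With this [eta] and the next [delta], each of the two terms of [integral_functional_le] is at
   most [e / 4], and its factor 2 brings the total to [e]. The measure [M] may be 0, hence
   [M + 1]. *)
pose eta := e / (4 * (M + 1)).
have eta0 : 0 < eta by rewrite divr_gt0// mulr_gt0// ltr_wpDl.
pose delta := e / (4 * eta `^ (1 - p)).
have delta0 : 0 < delta by rewrite divr_gt0// mulr_gt0// powR_gt0.
have d0 : 0 < delta `^ p^-1 by rewrite powR_gt0.
apply: filterS (nbhsx_ballx f _ d0) => g.
rewrite ballEmdist/= -[mdist f g]/(Lp_norm (f - g) `^ Num.min 1 p) => fg.
have -> : integral_functional E f - integral_functional E g =
    integral_functional E (f - g).
  have := integral_functional_linear p1 mE (-1) g f.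
  by rewrite scaleN1r [X in _ X = _]addrC => ->; rewrite scaleN1r addrC.
rewrite normcE lecR (le_trans (integral_functional_le _ p1 eta0 mE))//.
have fgp : Lp_norm (f - g) `^ p <= delta.
  move: fg; rewrite (min_l p1) powRr1 ?Lp_norm_ge0// => fg.
  rewrite -(@powRKV _ delta p _ (ltW delta0)) ?gt_eqF//.
  by rewrite le_powR ?(ltW p0) ?Lp_norm_ge0// ltW.
have h1 : eta * M <= e / 4.
  rewrite /eta invfM mulrA -mulrA -[leRHS]mulr1 ler_wpM2l ?divr_ge0 ?(ltW e0)//.
  by rewrite mulrC ler_pdivrMr ?ltr_wpDl// mul1r lerDl.
have h2 : eta `^ (1 - p) * Lp_norm (f - g) `^ p <= e / 4.
  apply: (le_trans (ler_wpM2l (powR_ge0 _ _) fgp)).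
  have t0 : 0 < eta `^ (1 - p) by rewrite powR_gt0.
  rewrite /delta le_eqVlt; apply/orP; left; apply/eqP.
  by field; rewrite gt_eqF.
by lra.
Qed.

(** The functionals [integral_functional E] suffice: if all vanish at [f], the real and imaginary
    parts of [f] have zero integral over every measurable set, hence are zero almost everywhere. *)
Lemma Lp_dual_separates f : 1 <= p ->
  (forall phi : Lp_dual mu p0, sval phi f = 0) -> f = 0.
Proof.
move=> p1 f0.
have E0 E : measurable E -> integral_functional E f = 0.
  move=> mE; exact: (f0 (exist _ _ (conj (integral_functional_linear p1 mE)
    (integral_functional_continuous p1 mE)))).
have [mr mi] := Lp_cmeasurable f.
have rE0 : ae_eq mu setT (fun x => (complex.Re (f x))%:E) (cst 0%E).
  apply: integral_ae_eq => //; first exact: Re_integrable.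
  move=> E _ mE; rewrite integral0.
  have := congr1 (@complex.Re R) (E0 E mE); rewrite /= /Rintegral => h.
  by rewrite -[LHS]fineK ?h// (integrable_fin_num mE)//; exact: Re_integrable.
have iE0 : ae_eq mu setT (fun x => (complex.Im (f x))%:E) (cst 0%E).
  apply: integral_ae_eq => //; first exact: Im_integrable.
  move=> E _ mE; rewrite integral0.
  have := congr1 (@complex.Im R) (E0 E mE); rewrite /= /Rintegral => h.
  by rewrite -[LHS]fineK ?h// (integrable_fin_num mE)//; exact: Im_integrable.
apply/LpP; apply: filterS3 rE0 iE0 (Lp_fun0 mu p0) => x /(_ I) r0 /(_ I) i0 ->.
by case: (f x) r0 i0 => a b /= [->] [->].
Qed.

End dual_separation.

(** * Strong and weak convergence *)

Section convergence_modes.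
Context d (T : measurableType d) (R : realType).
Variables (mu : {finite_measure set T -> \bar R}) (p : R) (p0 : 0 < p).
Local Notation L := (Lp mu p0).
Let rho : R := Num.min 1 p.

(* The common features of strong and weak convergence used in the compactness
   argument, so that both cases share one proof. *)
Record convergence_mode (conv : (nat -> L) -> L -> Prop) : Prop := {
  mode_cst : forall f, conv (fun=> f) f ;
  mode_sub : forall u f k, increasing_seq k -> conv u f -> conv (u \o k) f ;
  mode_shift : forall u f N, conv (fun n => u (n + N)%N) f -> conv u f ;
  mode_add : forall u v f g, conv u f -> conv v g ->
    conv (fun n => u n + v n) (f + g) ;
  mode_scale : forall (r : nat -> R) (l : R) u f,
    r n @[n --> \oo] --> l -> conv u f ->
    conv (fun n => (r n)%:C%C *: u n) (l%:C%C *: f) ;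
  mode_approx : forall u f, (forall e, 0 < e -> exists v g, [/\ conv v g,
      forall n, Lp_norm (u n - v n) `^ rho <= e & Lp_norm (f - g) `^ rho <= e]) ->
    conv u f ;
  mode_unique : forall u f g, conv u f -> conv u g -> f = g }.

Definition strong_cvg (u : nat -> L) (f : L) := u n @[n --> \oo] --> f.

Definition weak_cvg (u : nat -> L) (f : L) :=
  (u n : weak_Lp mu p0) @[n --> \oo] --> (f : weak_Lp mu p0).

Lemma strong_cvgP u f : strong_cvg u f <->
  Lp_norm (f - u n) `^ rho @[n --> \oo] --> 0.
Proof. exact: cvg_mdistP. Qed.

Lemma cvg0_squeeze (a b : nat -> R) : (forall n, 0 <= a n <= b n) ->
  b n @[n --> \oo] --> 0 -> a n @[n --> \oo] --> 0.
Proof.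
move=> ab b0; have h : \forall n \near \oo, cst 0 n <= a n <= b n by apply: nearW.
exact: (squeeze_cvgr h (cvg_cst 0) b0).
Qed.

Lemma Lp_dist_normC (f g : L) : Lp_norm (f - g) = Lp_norm (g - f).
Proof. by rewrite -opprB Lp_normN. Qed.

Lemma strong_mode : convergence_mode strong_cvg.
Proof.
have rho_gt0 : 0 < rho := min1_gt0 p0.
split.
- by move=> f; exact: cvg_cst.
- by move=> u f k ki uf; exact: (cvg_comp _ _ (increasing_cvg ki) uf).
- move=> u f N /strong_cvgP uf; apply/strong_cvgP.
  by rewrite -(cvg_shiftn N).
- move=> u v f g /strong_cvgP uf /strong_cvgP vg; apply/strong_cvgP.
  have uv0 : Lp_norm (f - u n) `^ rho + Lp_norm (g - v n) `^ rho @[n --> \oo] --> 0.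
    by rewrite -[X in _ --> X](addr0 0); exact: cvgD.
  apply: cvg0_squeeze uv0 => n; rewrite powR_ge0/=.
  by rewrite opprD addrACA Lp_normD.
- move=> r l u f rl /strong_cvgP uf; apply/strong_cvgP.
  have h1 : `|r n| `^ rho * Lp_norm (f - u n) `^ rho @[n --> \oo] --> 0.
    rewrite -(mulr0 (`|l| `^ rho)); apply: cvgM => //.
    by apply: cvg_powR => //; exact: cvg_norm.
  have h2 : `|l - r n| `^ rho * Lp_norm f `^ rho @[n --> \oo] --> 0.
    rewrite -[X in _ --> X](mul0r (Lp_norm f `^ rho)); apply: cvgM; last exact: cvg_cst.
    rewrite -[X in _ --> X](@powR0 _ rho) ?gt_eqF//.
    apply: cvg_powR => //; rewrite -(normr0 R) -(subrr l).
    by apply: cvg_norm; apply: cvgB => //; exact: cvg_cst.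
  have h12 : `|r n| `^ rho * Lp_norm (f - u n) `^ rho +
      `|l - r n| `^ rho * Lp_norm f `^ rho @[n --> \oo] --> 0.
    by rewrite -[X in _ --> X](addr0 0); exact: cvgD.
  apply: cvg0_squeeze h12 => n; rewrite powR_ge0/=.
  (* The first term is small as [u n] tends to [f] with [r n] bounded, the second as [r n] tends to
     [l]. *)
  have -> : l%:C%C *: f - (r n)%:C%C *: u n =
      (r n)%:C%C *: (f - u n) + (l - r n)%:C%C *: f.
    by rewrite rmorphB scalerBl scalerBr [RHS]addrC subrKA.
  rewrite (le_trans (Lp_normD _ _))// !Lp_normZ !normc_real.
  by rewrite !powRM ?Lp_norm_ge0.
- move=> u f h; apply/strong_cvgP/cvgrPdist_le => e e0.
  have e30 : 0 < e / 3 by rewrite divr_gt0.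
  have [v [g [/strong_cvgP/cvgrPdist_le vg uv fg]]] := h _ e30.
  have := vg _ e30; apply: filterS => n.
  rewrite !sub0r !normrN !ger0_norm ?powR_ge0// => gvn.
  have -> : f - u n = (f - g) + ((g - v n) + (v n - u n)) by rewrite !subrKA.
  apply: (le_trans (Lp_normD _ _)).
  have h2 := Lp_normD (g - v n) (v n - u n).
  have uvn := uv n; rewrite Lp_dist_normC in uvn.
  rewrite -/rho in h2 *; lra.
- move=> u f g uf ug; apply: cvg_unique uf ug; exact: metric_hausdorff.
Qed.

(** Uniqueness comes from [Lp_dual_separates]. For [mode_approx], a continuous linear functional is
    uniformly small on small balls, so an approximation in norm uniform in [n] survives its
    application. *)
Lemma weak_mode : 1 <= p -> convergence_mode weak_cvg.
Proof.
move=> p1.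
have lin0 (phi : Lp_dual mu p0) : sval phi 0 = 0.
  case: phi => phi [/= lphi _].
  by have := lphi (-1) 0 0; rewrite scaler0 addr0 scaleN1r addNr.
have linD (phi : Lp_dual mu p0) f g : sval phi (f + g) = sval phi f + sval phi g.
  case: phi => phi [/= lphi _].
  by have := lphi 1 f g; rewrite !scale1r.
have linZ (phi : Lp_dual mu p0) a f : sval phi (a *: f) = a * sval phi f.
  have l0 := lin0 phi; case: phi l0 => phi [/= lphi _] l0.
  by have := lphi a f 0; rewrite !addr0 l0 addr0.
have linB (phi : Lp_dual mu p0) f g : sval phi (f - g) = sval phi f - sval phi g.
  by rewrite linD -scaleN1r linZ mulN1r.
split.
- by move=> f; apply/weak_cvgP => phi; exact: cvg_cst.
- move=> u f k ki /weak_cvgP uf; apply/weak_cvgP => phi.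
  exact: (cvg_comp _ _ (increasing_cvg ki) (uf phi)).
- move=> u f N /weak_cvgP uf; apply/weak_cvgP => phi.
  by rewrite -(cvg_shiftn N); exact: uf.
- move=> u v f g /weak_cvgP uf /weak_cvgP vg; apply/weak_cvgP => phi.
  under eq_fun do rewrite linD.
  by rewrite linD; apply: cvgD; [exact: uf|exact: vg].
- move=> r l u f rl /weak_cvgP uf; apply/weak_cvgP => phi.
  under eq_fun do rewrite linZ.
  rewrite linZ; apply: cvgM; last exact: uf.
  apply/cvgrPdist_le => z /gt0_complexE[-> e0].
  have /cvgrPdist_le /(_ _ e0) := rl; apply: filterS => n.
  by rewrite -rmorphB normcE normc_real lecR.
- move=> u f h; apply/weak_cvgP => phi.
  apply/cvgrPdist_lt => z /gt0_complexE[-> e0]; set e := complex.Re z in e0 *.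
  have e30 : 0 < e / 3 by rewrite divr_gt0.
  have [del del0 phidel] : exists2 del : R, 0 < del &
      forall g, Lp_norm g `^ rho <= del -> normc (sval phi g) < e / 3.
    have phic : {for (0 : L), continuous (sval phi)} by case: (phi) => ? [? c]; exact: c.
    have FF : Filter (nbhs (0 : L)) by exact: nbhs_filter.
    have := iffLR (@cvgrPdist_lt _ _ _ (nbhs (0 : L)) FF (sval phi) (sval phi 0)) phic.
    move=> /(_ ((e / 3)%:C)%C).
    rewrite ltcR => /(_ e30) /nbhs_ballP[r /= r0 rB].
    exists (r / 2); first by rewrite divr_gt0.
    move=> g gr; have := rB g; rewrite ballEmdist/=.
    rewrite -[mdist (0 : L) g]/(Lp_norm (0 - g) `^ rho) sub0r Lp_normN lin0 sub0r normrN.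
    rewrite normcE ltcR; apply.
    by rewrite (le_lt_trans gr)// ltr_pdivrMr// ltr_pMr// ?ltr1n.
  have [v [g [/weak_cvgP vg uv fg]]] := h _ del0.
  have /cvgrPdist_lt/(_ ((e / 3)%:C)%C) := vg phi.
  rewrite ltcR => /(_ e30); apply: filterS => n.
  rewrite !normcE !ltcR => gvn.
  have -> : sval phi f - sval phi (u n) = sval phi (f - g) +
      ((sval phi g - sval phi (v n)) + sval phi (v n - u n)).
    by rewrite !linB !subrKA.
  have h1 := phidel _ fg.
  have h2 : normc (sval phi (v n - u n)) < e / 3.
    by apply: phidel; rewrite Lp_dist_normC.
  apply: (le_lt_trans (le_normcD _ _)).
  have h3 := le_normcD (sval phi g - sval phi (v n)) (sval phi (v n - u n)).
  lra.
- move=> u f g /weak_cvgP uf /weak_cvgP ug.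
  apply/eqP; rewrite -subr_eq0; apply/eqP; apply: Lp_dual_separates => // phi.
  rewrite linB; apply/eqP; rewrite subr_eq0; apply/eqP.
  by apply: cvg_unique (uf phi) (ug phi); exact: norm_hausdorff.
Qed.

Lemma mode_sum conv (I : eqType) (s : seq I) (F : I -> nat -> L) (l : I -> L) :
  convergence_mode conv -> {in s, forall i, conv (F i) (l i)} ->
  conv (fun n => \sum_(i <- s) F i n) (\sum_(i <- s) l i).
Proof.
move=> mc; elim: s => [|i s ih] h.
  rewrite big_nil (_ : (fun n => _) = fun=> 0); first exact: mode_cst.
  by apply/funext => n; rewrite big_nil.
rewrite big_cons (_ : (fun n => _) = fun n => F i n + \sum_(j <- s) F j n).
  apply: mode_add => //; first by apply: h; rewrite inE eqxx.
  by apply: ih => j js; apply: h; rewrite inE js orbT.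
by apply/funext => n; rewrite big_cons.
Qed.

Lemma Lp_norm_series_tail (f : nat -> L) (g : L) (N : nat) (e : R) :
  series f @ \oo --> g ->
  (forall m, \sum_(N <= k < m) Lp_norm (f k) `^ rho <= e) ->
  Lp_norm (g - series f N) `^ rho <= e.
Proof.
move=> /strong_cvgP fg h.
have h1 : Lp_norm (g - series f n) `^ rho + e @[n --> \oo] --> e.
  by rewrite -[X in _ --> X]add0r; apply: cvgD => //; exact: cvg_cst.
apply: (ler_cvg_to (cvg_cst _) h1); exists N => // n /= Nn.
rewrite -(subrKA (series f n)); apply: (le_trans (Lp_normD _ _)).
rewrite lerD2l (le_trans _ (h n))// sub_series_geq//.
exact: Lp_norm_sum.
Qed.

End convergence_modes.

(** * Besov balls *)

Lemma lq_le_pointwise (R : realType) (q : \bar R) (x y : nat -> R) (D : R) :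
  (0 < q)%E -> (forall k, 0 <= x k <= y k) -> lq_le q y D -> lq_le q x D.
Proof.
case: q => [t| |]//= t0 xy h n; last by apply: le_trans (h n); case/andP: (xy n).
apply: le_trans (h n); apply: ler_sum => k _; have /andP[x0 xyk] := xy k.
by rewrite le_powR// -lee_fin ltW.
Qed.

Section besov_compactness.
Context d (T : measurableType d) (R : realType).
Variables (m : {finite_measure set T -> \bar R}) (s p : R) (q u : \bar R).
Variables (s0 : 0 < s) (p0 : 0 < p) (q0 : (0 < q)%E) (u1 : (1 <= u)%E).
Variable P : nat -> {fset set T}.
Hypotheses (gridP : grid m P) (g1P : G1 P) (g2P : G2 m s p q P).
Variables (B : set T -> set (Lp m p0)) (NB : set T -> Lp m p0 -> R).
Variable A : set T -> set (Lp m p0).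
Hypothesis atomsA : atoms P s u B NB A.

Local Notation L := (Lp m p0).
Let rho0 : R := Num.min 1 p.
Let rho0_gt0 : 0 < rho0 := min1_gt0 p0.

Definition level_lp (c : set T -> R) (k : nat) : R :=
  (\sum_(Q <- P k) c Q `^ p) `^ p^-1.

Lemma level_lp_ge0 c k : 0 <= level_lp c k.
Proof. exact: powR_ge0. Qed.

(** Translates the extended-real cost into [lq_le], the form in which the sequence lemmas apply. *)
Lemma cost_le_lq (c : set T -> R[i]) (C : R) : 0 <= C ->
  (cost p P q c <= C%:E)%E <-> lq_le q (level_lp (fun Q => normc (c Q))) C.
Proof.
move=> C0; rewrite /cost; case: q q0 => [r| |]//= r0; last first.
  split=> [h k|h]; first by rewrite -lee_fin (le_trans _ h)//; apply: ereal_sup_ubound; exists k.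
  by apply: ge_ereal_sup => _ [k _ <-]; rewrite lee_fin; exact: h.
rewrite lte_fin in r0.
set S := fun k => \sum_(Q <- P k) normc (c Q) `^ p.
have SE k : S k `^ (r / p) = level_lp (fun Q => normc (c Q)) k `^ r.
  by rewrite /level_lp -powRrM mulrC.
have ser0 : (0 <= \sum_(0 <= k <oo) (S k `^ (r / p))%:E)%E.
  by apply: nneseries_ge0 => k _ _; rewrite lee_fin powR_ge0.
have -> : ((\sum_(0 <= k <oo) (S k `^ (r / p))%:E) `^ r^-1 <= C%:E)%E <->
    (\sum_(0 <= k <oo) (S k `^ (r / p))%:E <= (C `^ r)%:E)%E.
  rewrite -poweR_EFin; split=> h.
    have := @le_poweR _ _ _ r (ltW r0) (poweR_ge0 _ _) h.
    by rewrite -poweRrM mulVf ?gt_eqF// poweRe1.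
  have ri : 0 <= r^-1 by rewrite invr_ge0 ltW.
  have := le_poweR ri ser0 h.
  by rewrite -poweRrM divff ?gt_eqF// poweRe1// lee_fin.
split=> [h n|h].
  rewrite -lee_fin (le_trans _ h)// -sumEFin.
  under eq_bigr do rewrite -SE.
  by apply: nneseries_lim_ge => k _ _; rewrite lee_fin powR_ge0.
apply: lime_le; first by apply: is_cvg_nneseries => k _ _; rewrite lee_fin powR_ge0.
apply: nearW => n; rewrite sumEFin lee_fin; under eq_bigr do rewrite SE.
exact: h.
Qed.

Definition atom_family (a : set T -> L) := forall Q, in_grid P Q -> A Q (a Q).

Definition real_level (r : set T -> R) (a : set T -> L) : nat -> L :=
  level_sum P (fun Q => (r Q)%:C%C) a.

(* [g] has an atomic representation of cost at most [C] whose coefficients are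
   nonnegative reals: their phases are absorbed by the atoms. *)
Definition representable (C : R) (g : L) := exists r a,
  [/\ forall Q, 0 <= r Q, atom_family a, lq_le q (level_lp r) C &
      series (real_level r a) @ \oo --> g].

Lemma grid_finite_measure : (m setT < +oo)%E.
Proof. by rewrite ltey_eq fin_num_measure. Qed.

Lemma atom_norm Q f : in_grid P Q -> A Q f -> Lp_norm f <= fine (m Q) `^ s.
Proof.
move=> gQ Af; have [[_ _] vB [AB _ _ _] Asz] := atomsA gQ.
have [k QP] := gQ; have [gm _ _] := gridP; have [mQ Q0] := gm _ _ QP.
apply: (Lp_norm_atom u1 mQ Q0) => //.
- by rewrite ltey_eq fin_num_measure.
- by apply: vB; exact: AB.
- exact: Asz.
Qed.

Lemma level_norm (M : nat) (r : set T -> R) (a : set T -> L) k :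
  (forall k Q, Q \in P k ->
    (#|` [fset Q' in P k | (Q' `&` Q)%classic != set0]%fset | <= M)%N) ->
  (forall Q, 0 <= r Q) -> atom_family a ->
  Lp_norm (real_level r a k) <= M%:R * mesh m P k `^ s * level_lp r k.
Proof.
move=> PM r_ge0 aA.
have := @Lp_norm_level _ T R m p p0 P s M k (fun Q => (r Q)%:C%C) a s0 gridP
  grid_finite_measure PM.
rewrite /level_lp (eq_bigr (fun Q => r Q `^ p)); last first.
  by move=> Q _; rewrite normc_real ger0_norm.
apply=> Q QP; have gQ : in_grid P Q by exists k.
  have [_ vB [AB _ _ _] _] := atomsA gQ; apply: vB; apply: AB; exact: aA.
by apply: atom_norm => //; exact: aA.
Qed.

(** * Uniform control of the tails of representations *)

Lemma hoelder_conjugate_fine_gt0 (x : \bar R) : (1 < x)%E -> 0 < fine (hoelder_conjugate x).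
Proof.
move=> x1; have h1 := hoelder_conj_ge1 (ltW x1).
have hy : hoelder_conjugate x != +oo%E.
  by apply/eqP => /hoelder_conjugate_eqy xE; rewrite xE ltxx in x1.
rewrite fine_gt0//; apply/andP; split; first exact: (lt_le_trans lte01 h1).
by rewrite ltey.
Qed.

(** The finiteness of [Gamma] in the form [lq_tail] uses. If [p >= 1] then [rho0 = 1] and
    [(mesh^(s p))^(q' / p) = mesh^(s q')]; if [p < 1] then [rho0 = p] and the conjugate is that of
    [q / p]. When [q <= rho0], the limit of the mesh takes over. *)
Lemma G2_sum : (1 < q / rho0%:E)%E ->
  (\sum_(0 <= k <oo) ((mesh m P k `^ s) `^ rho0 `^
     fine (hoelder_conjugate (q / rho0%:E)))%:E < +oo)%E.
Proof.
have fin (x : \bar R) (e : R) : 0 < e -> (0 <= x)%E -> (x `^ e < +oo)%E -> (x < +oo)%E.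
  move=> e0 x0 h; rewrite ltey; apply/eqP => xE; move: h.
  by rewrite xE poweRyr ?gt_eqF.
have [+ _] := g2P; rewrite /Gamma /rho0; have [p1|p1] := leP 1 p.
  rewrite inve1 mule1 => + q1; rewrite q1.
  have q'0 := hoelder_conjugate_fine_gt0 q1.
  move/fin; rewrite invr_gt0 => /(_ q'0) H; apply: le_lt_trans (H _).
    rewrite le_eqVlt; apply/orP; left; apply/eqP.
    have e (x z : R) : (x `^ s) `^ 1 `^ z = (x `^ (s * p)) `^ (z / p).
      have sz : s * z = s * p * (z / p) by field; rewrite gt_eqF.
      by rewrite powRr1 ?powR_ge0// -powRrM sz powRrM.
    by apply: eq_eseriesr => k _; rewrite e.
  by apply: nneseries_ge0 => k _ _; rewrite lee_fin powR_ge0.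
have pq : (1 < q / p%:E)%E = (p%:E < q)%E.
  case: q q0 => [r| |]//= r0.
    by rewrite inver gt_eqF//= !lte_fin ltr_pdivlMr// mul1r.
  by rewrite inver gt_eqF// gt0_mulye ?lte_fin ?invr_gt0 ?ltry.
move=> + q1; rewrite -pq q1.
have q'0 := hoelder_conjugate_fine_gt0 q1.
move/fin; rewrite invr_gt0 mulr_gt0// => /(_ isT) H; apply: le_lt_trans (H _).
  rewrite le_eqVlt; apply/orP; left; apply/eqP.
  by apply: eq_eseriesr => k _; rewrite (powRrM _ s p).
by apply: nneseries_ge0 => k _ _; rewrite lee_fin powR_ge0.
Qed.

(** By [level_norm] the [k]-th term is at most [beta k] times [level_lp r k ^ rho0], and the latter
    sequence lies in a ball of [l^(q / rho0)]; so [lq_tail] gives an [N] depending only on [D] and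
    [e]. *)
Lemma uniform_tail (D e : R) : 0 <= D -> 0 < e ->
  exists N, forall r a, (forall Q, 0 <= r Q) -> atom_family a ->
    lq_le q (level_lp r) D ->
    forall n, \sum_(N <= k < n) Lp_norm (real_level r a k) `^ rho0 <= e.
Proof.
move=> D0 e0; have [M PM] := g1P.
pose beta k := (M%:R * mesh m P k `^ s) `^ rho0.
have b0 k : 0 <= M%:R * mesh m P k `^ s by rewrite mulr_ge0// powR_ge0.
have blim : beta k @[k --> \oo] --> 0.
  rewrite -[X in _ --> X](@powR0 _ rho0) ?gt_eqF//; apply: cvg_powR => //.
  rewrite -[X in _ --> X](mulr0 (M%:R : R)); apply: cvgM; first exact: cvg_cst.
  rewrite -[X in _ --> X](@powR0 _ s) ?gt_eqF//; apply: cvg_powR => //.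
    by move=> n; exact: mesh_ge0.
  by have [] := g2P.
have q'0 : (0 < q / rho0%:E)%E.
  by rewrite mule_gt0// inver gt_eqF// lte_fin invr_gt0.
have bsum : (1 < q / rho0%:E)%E -> (\sum_(0 <= k <oo)
    (beta k `^ fine (hoelder_conjugate (q / rho0%:E)))%:E < +oo)%E.
  move=> q1; set t := fine _.
  under eq_eseriesr => k _.
    rewrite /beta powRM ?powR_ge0// powRM ?powR_ge0// EFinM; over.
  rewrite nneseriesZl; last by move=> k _; rewrite lee_fin powR_ge0.
  by rewrite lte_mul_pinfty ?lee_fin ?powR_ge0//; exact: G2_sum.
have [N NP] := lq_tail q'0 (fun k => powR_ge0 _ _) blim bsum (powR_ge0 D rho0) e0.
exists N => r a r_ge0 aA rD n.
apply: (le_trans _ (NP (fun k => level_lp r k `^ rho0) (fun k => powR_ge0 _ _)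
  (lq_le_powR q0 rho0_gt0 D0 (level_lp_ge0 r) rD) n)).
apply: ler_sum => k _; rewrite /beta -powRM ?level_lp_ge0//.
by rewrite le_powR ?(ltW rho0_gt0) ?Lp_norm_ge0//; exact: level_norm.
Qed.

Lemma levels_summable D r a : 0 <= D -> (forall Q, 0 <= r Q) -> atom_family a ->
  lq_le q (level_lp r) D ->
  (\sum_(0 <= k <oo) (Lp_norm (real_level r a k) `^ rho0)%:E < +oo)%E.
Proof.
move=> D0 r_ge0 aA rD; have [N NP] := uniform_tail D0 ltr01.
have f0 k : (0 <= (Lp_norm (real_level r a k) `^ rho0)%:E)%E by rewrite lee_fin powR_ge0.
rewrite (nneseries_split 0 N)// add0n lte_add_pinfty//.
  by rewrite sumEFin ltry.
apply: (@le_lt_trans _ _ 1%E); last exact: ltry.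
apply: lime_le; first exact: is_cvg_nneseries.
by apply: nearW => n; rewrite sumEFin lee_fin; exact: NP.
Qed.

(** The value 1 at 0 makes every phase unimodular, so that (A3) always applies. *)
Definition phase (z : R[i]) : R[i] := if z == 0 then 1 else z / (normc z)%:C%C.

Lemma phaseE z : z = (normc z)%:C%C * phase z.
Proof.
rewrite /phase; have [->|z0] := eqVneq z 0; first by rewrite Normc.normc0 mul0r.
rewrite mulrCA divff ?mulr1//; apply/eqP => -[/Normc.eq0_normc zE].
by rewrite zE eqxx in z0.
Qed.

Lemma normc_phase z : normc (phase z) = 1.
Proof.
rewrite /phase; have [_|z0] := eqVneq z 0; first exact: Normc.normc1.
have nz : normc z != 0 by apply: contra z0 => /eqP/Normc.eq0_normc ->.
by rewrite Normc.normcM -fmorphV normc_real ger0_norm ?invr_ge0 ?normc_ge0// divff.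
Qed.

Lemma atom_phase Q f z : in_grid P Q -> A Q f -> A Q (phase z *: f).
Proof.
move=> gQ Af; have [_ _ [_ _ _ Aph] _] := atomsA gQ.
by apply: (Aph f).1 => //; exact: normc_phase.
Qed.

(** * Real representations and the Besov norm *)

Lemma atomic_representation_real (C : R) (g : L) c a : 0 <= C ->
  atomic_representation P A g c a -> (cost p P q c <= C%:E)%E -> representable C g.
Proof.
move=> C0 [aA _ ag] /(cost_le_lq _ C0) cC.
exists (fun Q => normc (c Q)), (fun Q => phase (c Q) *: a Q); split=> //.
- by move=> Q; exact: normc_ge0.
- by move=> Q gQ; apply: atom_phase => //; exact: aA.
rewrite (_ : real_level _ _ = level_sum P c a)//.
apply/funext => k; rewrite /real_level /level_sum; apply: eq_bigr => Q _.
by rewrite scalerA -phaseE.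
Qed.

(** Identifies the exponent of absolute convergence in [atomic_representation] with that of the
    metric of [L^p]. *)
Lemma min_max1 : p / Num.max 1 p = rho0.
Proof.
rewrite /rho0; have [p1|p1] := leP 1 p; last by rewrite divr1.
by rewrite divff ?gt_eqF.
Qed.

(** The bound on the cost yields the absolute convergence, through [levels_summable]. *)
Lemma representable_atomic (C : R) (g : L) : 0 <= C -> representable C g ->
  exists c a, atomic_representation P A g c a /\ (cost p P q c <= C%:E)%E.
Proof.
move=> C0 [r [a [r_ge0 aA rC ag]]].
exists (fun Q => (r Q)%:C%C), a; split; last first.
  apply: (iffRL (cost_le_lq (fun Q => (r Q)%:C%C) C0)).
  rewrite (_ : (fun Q => normc _) = r)//.
  by apply/funext => Q; rewrite normc_real ger0_norm.
split=> //; rewrite min_max1; exact: levels_summable rC.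
Qed.

Lemma cost_ge0 c : (0 <= cost p P q c)%E.
Proof.
rewrite /cost; case: q => [r| |]; first exact: poweR_ge0.
  apply: (@le_trans _ _ ((\sum_(Q <- P 0%N) normc (c Q) `^ p) `^ p^-1)%:E).
    by rewrite lee_fin powR_ge0.
  by apply: ereal_sup_ubound; exists 0%N.
apply: (@le_trans _ _ ((\sum_(Q <- P 0%N) normc (c Q) `^ p) `^ p^-1)%:E).
  by rewrite lee_fin powR_ge0.
by apply: ereal_sup_ubound; exists 0%N.
Qed.

Lemma besov_norm_ge0 g : 0 <= besov_norm P q A g.
Proof.
rewrite fine_ge0//; apply: le_ereal_inf_tmp => _ [c [a [_ ->]]]; exact: cost_ge0.
Qed.

Lemma representable_besov (C : R) (g : L) : 0 <= C -> representable C g ->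
  besov P q A g /\ besov_norm P q A g <= C.
Proof.
move=> C0 /(representable_atomic C0)[c [a [ga cC]]]; split.
  by exists c, a; split=> //; exact: le_lt_trans cC (ltry _).
rewrite /besov_norm; set I := ereal_inf _.
have IC : (I <= C%:E)%E.
  by apply: le_trans cC; apply: ereal_inf_lbound; exists c, a.
have I0 : (0 <= I)%E.
  by apply: le_ereal_inf_tmp => _ [? [? [_ ->]]]; exact: cost_ge0.
rewrite -lee_fin fineK// ge0_fin_numE//; exact: le_lt_trans IC (ltry _).
Qed.

(** The slack [e] is what an infimum provides; [besov_attained] removes it by compactness. *)
Lemma besov_representable (C e : R) (g : L) : besov P q A g ->
  besov_norm P q A g <= C -> 0 < e -> representable (C + e) g.
Proof.
move=> [c0 [a0 [ga0 c0oo]]]; rewrite /besov_norm; set E := [set _ | _] => IC e0.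
have I0 : (0 <= ereal_inf E)%E.
  by apply: le_ereal_inf_tmp => _ [? [? [_ ->]]]; exact: cost_ge0.
have Ifin : ereal_inf E \is a fin_num.
  rewrite ge0_fin_numE//; apply: le_lt_trans c0oo.
  by apply: ereal_inf_lbound; exists c0, a0.
have C0 : 0 <= C by apply: le_trans IC; exact: fine_ge0.
have : (ereal_inf E < (C + e)%:E)%E.
  by rewrite -(fineK Ifin) lte_fin (le_lt_trans IC)// ltrDl.
move=> /ereal_inf_lt[_ [c [a [ga ->]]] cC].
by apply: (atomic_representation_real _ ga (ltW cC)); rewrite addr_ge0// ltW.
Qed.

Definition mode_compact (conv : (nat -> L) -> L -> Prop) (K : set L) :=
  forall v : nat -> L, (forall n, K (v n)) -> exists2 k : nat -> nat, increasing_seq k &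
    exists2 l, K l & conv (v \o k) l.

Lemma level_lp_coord r Q k : (forall Q, 0 <= r Q) -> Q \in P k -> r Q <= level_lp r k.
Proof.
move=> r_ge0 QP; rewrite -(@powRK _ (r Q) p) ?gt_eqF//.
apply: le_powR; rewrite ?invr_ge0 ?(ltW p0) ?powR_ge0//.
by rewrite (big_rem Q)//= lerDl sumr_ge0// => ? _; exact: powR_ge0.
Qed.

Lemma bounded_subsequence (v : nat -> R) (D : R) : (forall n, 0 <= v n <= D) ->
  exists2 k : nat -> nat, increasing_seq k & exists2 l : R, 0 <= l & v (k n) @[n --> \oo] --> l.
Proof.
move=> vD; have [|k ki /cvg_ex[l vl]] := @bolzano_weierstrass R v.
  exists D; split; first exact: num_real.
  move=> x Dx n _ /=; have /andP[v0 vDn] := vD n.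
  by rewrite ger0_norm// (le_trans vDn)// ltW.
exists k => //; exists l => //.
by apply: (ler_cvg_to (cvg_cst 0) vl); apply: nearW => n; case/andP: (vD (k n)).
Qed.

(** * Vector-space operations on representations *)

Lemma atom_exists : exists a, atom_family a.
Proof.
have /choice[a aP] : forall Q, exists f : L, in_grid P Q -> A Q f.
  move=> Q; have [gQ|ngQ] := pselect (in_grid P Q); last by exists 0.
  by have [_ _ [_ [f Af] _ _] _] := atomsA gQ; exists f.
by exists a.
Qed.

Lemma atom_convex Q (f g : L) (t t' : R) : in_grid P Q -> A Q f -> A Q g ->
  0 <= t -> 0 <= t' -> t + t' = 1 -> A Q (t%:C%C *: f + t'%:C%C *: g).
Proof.
move=> gQ Af Ag t0 t'0 tt'; have [_ _ [_ _ Acv _] _] := atomsA gQ.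
have c0 : 0 <= t%:C%C :> R[i] by rewrite lecR.
have c1 : t%:C%C <= 1 :> R[i] by rewrite (_ : 1 = (1 : R)%:C%C)// lecR -tt' lerDl.
have -> : t'%:C%C = unstable.onem t%:C%C.
  by rewrite /unstable.onem (_ : 1 = (1 : R)%:C%C)// -rmorphB -tt' addrAC subrr add0r.
exact: (set_mem (Acv f g (Itv01 c0 c1) (mem_set Af) (mem_set Ag))).
Qed.

Lemma representable0 : representable 0 0.
Proof.
have [a aA] := atom_exists; exists (fun=> 0), a.
have l0 k : level_lp (fun=> 0) k = 0.
  by rewrite /level_lp big1 ?powR0 ?gt_eqF ?invr_gt0// => Q _; rewrite powR0 ?gt_eqF.
split=> //.
  case: q q0 => [r| |]//= r0; last by move=> k; rewrite l0.
  rewrite lte_fin in r0; move=> n; rewrite big1 ?powR_ge0// => k _.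
  by rewrite l0 powR0 ?gt_eqF.
rewrite (_ : series _ = fun=> 0); first exact: cvg_cst.
apply/funext => n; rewrite /series/= big1// => k _.
by rewrite /real_level /level_sum big1// => Q _; rewrite scale0r.
Qed.

Lemma representable_eq0 (g : L) : representable 0 g -> g = 0.
Proof.
move=> [r [a [r_ge0 aA r0 ag]]].
have l0 k : real_level r a k = 0.
  rewrite /real_level /level_sum big_seq big1// => Q QP.
  have : r Q <= 0.
    apply: (le_trans (level_lp_coord r_ge0 QP)).
    exact: (lq_le_coord _ q0 (level_lp_ge0 _) (lexx 0) r0).
  by rewrite -[r Q <= 0]andbT -(r_ge0 Q) -eq_le => /eqP ->; rewrite scale0r.
have a0 : strong_cvg (series (real_level r a)) 0.
  rewrite (_ : series _ = fun=> 0); first exact: cvg_cst.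
  by apply/funext => n; rewrite /series/= big1.
exact: (@mode_unique _ _ _ _ _ _ _ (strong_mode m p0) (series (real_level r a)) g 0 ag a0).
Qed.

(** The modulus of [z] goes to the coefficients and its phase to the atoms. *)
Lemma representableZ (C : R) (g : L) (z : R[i]) : 0 <= C -> representable C g ->
  representable (normc z * C) (z *: g).
Proof.
move=> C0 [r [a [r_ge0 aA rC ag]]].
exists (fun Q => normc z * r Q), (fun Q => phase z *: a Q); split.
- by move=> Q; rewrite mulr_ge0 ?normc_ge0.
- by move=> Q gQ; apply: atom_phase => //; exact: aA.
- have -> : level_lp (fun Q => normc z * r Q) = fun k => normc z * level_lp r k.
    apply/funext => k; rewrite /level_lp.
    under eq_bigr do rewrite powRM ?normc_ge0//.
    rewrite -mulr_sumr powRM ?powR_ge0 ?sumr_ge0// => [|Q _]; last exact: powR_ge0.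
    by rewrite powRK ?gt_eqF ?normc_ge0.
  exact: (lq_leZ q0 C0 (normc_ge0 z) (level_lp_ge0 r) rC).
rewrite (_ : series _ = fun n => z *: series (real_level r a) n).
  apply/strong_cvgP; have /strong_cvgP agP := ag.
  have H : normc z `^ rho0 * Lp_norm (g - series (real_level r a) n) `^ rho0
      @[n --> \oo] --> 0.
    by rewrite -[X in _ --> X](mulr0 (normc z `^ rho0)); apply: cvgM => //; exact: cvg_cst.
  apply: cvg_trans H; apply: near_eq_cvg; apply: nearW => n.
  by rewrite -scalerBr Lp_normZ powRM ?normc_ge0 ?Lp_norm_ge0.
apply/funext => n; rewrite /series/= scaler_sumr; apply: eq_bigr => k _.
rewrite /real_level /level_sum scaler_sumr; apply: eq_bigr => Q _.
by rewrite rmorphM !scalerA {3}(phaseE z); congr (_ *: _); ring.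
Qed.

(** Coefficients add up and atoms are averaged with weights [r / w] and [r' / w]. The cost is then
    bounded by two [rho]-triangle inequalities: [sum_powRD_le] inside a level, [lq_leD] across
    levels. *)
Lemma representableD (C D rho : R) (f g : L) : 0 <= C -> 0 <= D ->
  0 < rho <= 1 -> rho <= p -> (rho%:E <= q)%E ->
  representable C f -> representable D g ->
  representable ((C `^ rho + D `^ rho) `^ rho^-1) (f + g).
Proof.
move=> C0 D0 rho01 rhop rhoq [r [a [r_ge0 aA rC af]]] [r' [a' [r'_ge0 a'A r'D a'g]]].
have rho_gt0 : 0 < rho by case/andP: rho01.
pose w Q := r Q + r' Q.
(* If [w Q = 0], both coefficients vanish and any atom will do. *)
pose b Q := if w Q == 0 then a Q else
  (r Q / w Q)%:C%C *: a Q + (r' Q / w Q)%:C%C *: a' Q.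
have w0 Q : 0 <= w Q by rewrite addr_ge0.
exists w, b; split=> //.
- move=> Q gQ; rewrite /b; case: ifPn => [_|wn0]; first exact: aA.
  apply: atom_convex => //; rewrite ?divr_ge0//; [exact: aA|exact: a'A|].
  by rewrite -mulrDl divff.
- apply: lq_le_pointwise (lq_leD rho_gt0 rhoq (level_lp_ge0 r) (level_lp_ge0 r')
    C0 D0 rC r'D) => // k.
  rewrite level_lp_ge0/= -(@powRK _ (level_lp w k) rho) ?gt_eqF ?level_lp_ge0//.
  apply: le_powR; rewrite ?invr_ge0 ?(ltW rho_gt0) ?powR_ge0//.
  have e (c : set T -> R) : level_lp c k `^ rho = (\sum_(Q <- P k) c Q `^ p) `^ (rho / p).
    by rewrite /level_lp -powRrM mulrC.
  have pr0 : 0 < p / rho by rewrite divr_gt0.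
  apply: (powR_le_inv pr0); rewrite ?addr_ge0 ?powR_ge0//.
  have e' (c : set T -> R) : level_lp c k `^ rho `^ (p / rho) = \sum_(Q <- P k) c Q `^ p.
    rewrite -powRrM mulrC divfK ?gt_eqF// /level_lp powRKV ?gt_eqF// sumr_ge0// => Q _.
    exact: powR_ge0.
  rewrite e'; apply: (sum_powRD_le r_ge0 r'_ge0) => //; rewrite ?powR_ge0 ?e'//.
have -> : series (real_level w b) =
    fun n => series (real_level r a) n + series (real_level r' a') n.
  apply/funext => n; rewrite /series/= -big_split/=; apply: eq_bigr => k _.
  rewrite /real_level /level_sum -big_split/=; apply: eq_bigr => Q _.
  rewrite /b; case: ifPn => [|wn0].
    rewrite paddr_eq0// /w => /andP[/eqP -> /eqP ->].
    by rewrite addr0 !scale0r addr0.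
  by rewrite scalerDr !scalerA -!rmorphM !mulrA ![w Q * _]mulrC !mulfK.
exact: (mode_add (strong_mode m p0) af a'g).
Qed.

(** * Compactness of Besov balls in a convergence mode *)

Section mode.
Variable conv : (nat -> L) -> L -> Prop.
Hypothesis mc : convergence_mode conv.
Hypothesis Ac : forall Q, in_grid P Q -> mode_compact conv (A Q).

Lemma coefficients_subsequence (r : nat -> set T -> R) (a : nat -> set T -> L) (D : R) :
  0 <= D -> (forall n Q, 0 <= r n Q) -> (forall n, atom_family (a n)) ->
  (forall n, lq_le q (level_lp (r n)) D) ->
  exists2 k : nat -> nat, increasing_seq k & exists (r' : set T -> R) (a' : set T -> L),
    [/\ forall Q, 0 <= r' Q, atom_family a' &
        forall Q, in_grid P Q -> r (k n) Q @[n --> \oo] --> r' Q /\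
          conv (fun n => a (k n) Q) (a' Q)].
Proof.
move=> D0 r_ge0 aA rD.
pose lim_at Q k := exists x : R * L, [/\ 0 <= x.1, A Q x.2,
  r (k n) Q @[n --> \oo] --> x.1 & conv (fun n => a (k n) Q) x.2].
(* Enumerates the cells by coding a level and a position in one number. The default [set0] may lie
   outside the grid, so the property below is conditional on [in_grid]. *)
pose cube (i : nat) := let kj : nat * nat := odflt (0, 0)%N (choice.unpickle i) in nth set0 (P kj.1) kj.2.
have [|||k ki kP] := @diagonal_subsequence
    (fun (i : nat) (k : nat -> nat) => in_grid P (cube i) -> lim_at (cube i) k).
- move=> i t ti; set Q := cube i; have [gQ|ngQ] := pselect (in_grid P Q); last first.
    by exists id => // /ngQ.
  have [j QP] := gQ.
  have [|k1 k1i [l l0 rl]] := @bounded_subsequence (fun n => r (t n) Q) D.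
    move=> n; rewrite r_ge0/= (le_trans (level_lp_coord (r_ge0 _) QP))//.
    exact: (lq_le_coord _ q0 (level_lp_ge0 _) D0 (rD _)).
  have [|k2 k2i [f Af af]] := Ac gQ (v := fun n => a (t (k1 n)) Q).
    by move=> n; exact: aA.
  exists (k1 \o k2); first exact: increasing_seq_comp.
  move=> _; exists (l, f); split=> //=.
  exact: (cvg_comp _ _ (increasing_cvg k2i) rl).
- move=> i t k ki h gQ; have [x [x0 Ax rx ax]] := h gQ; exists x; split=> //.
    exact: (cvg_comp _ _ (increasing_cvg ki) rx).
  exact: (mode_sub mc ki ax).
- move=> i t N h gQ; have [x [x0 Ax rx ax]] := h gQ; exists x; split=> //.
    by rewrite -(cvg_shiftn N).
  exact: (mode_shift mc (N := N)).
have kQ Q : in_grid P Q -> lim_at Q k.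
  move=> gQ; have [j QP] := gQ.
  have cE : cube (choice.pickle (j, index Q (P j) : nat)) = Q.
    by rewrite /cube choice.pickleK/= nth_index.
  by rewrite -cE; apply: kP; rewrite cE.
(* Nonnegativity is kept outside the condition because [representable] asks for it at every set. *)
have /choice[x xP] : forall Q, exists x : R * L, 0 <= x.1 /\ (in_grid P Q ->
    [/\ A Q x.2, r (k n) Q @[n --> \oo] --> x.1 & conv (fun n => a (k n) Q) x.2]).
  move=> Q; have [gQ|ngQ] := pselect (in_grid P Q); last by exists (0, 0).
  by have [x [x0 Ax rx ax]] := kQ Q gQ; exists x.
exists k => //; exists (fun Q => (x Q).1), (fun Q => (x Q).2); split.
- by move=> Q; have [] := xP Q.
- by move=> Q gQ; have [_ /(_ gQ)[]] := xP Q.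
- by move=> Q gQ; have [_ /(_ gQ)[]] := xP Q.
Qed.

Lemma level_lp_cvg (r : nat -> set T -> R) (r' : set T -> R) k : (forall n Q, 0 <= r n Q) ->
  (forall Q, in_grid P Q -> r n Q @[n --> \oo] --> r' Q) ->
  level_lp (r n) k @[n --> \oo] --> level_lp r' k.
Proof.
move=> r_ge0 rr'; apply: cvg_powR; rewrite ?invr_gt0//.
  by move=> n; apply: sumr_ge0 => Q _; exact: powR_ge0.
rewrite [X in _ --> X]big_seq; under eq_fun do rewrite big_seq.
apply: cvg_big => [|Q QP]; first exact: add_continuous.
by apply: cvg_powR => //; apply: rr'; exists k.
Qed.

(** The limit [h] is the sum of the limiting representation. By [mode_approx] it is enough to
    compare partial sums up to one [N] serving all indices: these converge as finite sums, and both
    tails are small by [uniform_tail]. The slack [1 / (n + 1)] vanishes in the limit of the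
    costs. *)
Theorem besov_subsequence (C : R) (g : nat -> L) : 0 <= C ->
  (forall n, representable (C + n.+1%:R^-1) (g n)) ->
  exists2 k : nat -> nat, increasing_seq k & exists2 h, representable C h & conv (g \o k) h.
Proof.
move=> C0 gC; pose D := C + 1.
have D0 : 0 <= D by rewrite addr_ge0.
have n1 n : n.+1%:R^-1 <= 1 :> R by rewrite invf_le1// ler1n.
have /choice[ra raP] : forall n, exists ra : (set T -> R) * (set T -> L),
    [/\ forall Q, 0 <= ra.1 Q, atom_family ra.2,
      lq_le q (level_lp ra.1) (C + n.+1%:R^-1) &
      series (real_level ra.1 ra.2) @ \oo --> g n].
  by move=> n; have [r [a H]] := gC n; exists (r, a).
pose r n := (ra n).1; pose a n := (ra n).2.
have r_ge0 n Q : 0 <= r n Q by have [H _ _ _] := raP n; exact: H.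
have aA n : atom_family (a n) by have [_ H _ _] := raP n; exact: H.
have rC n : lq_le q (level_lp (r n)) (C + n.+1%:R^-1) by have [_ _ H _] := raP n; exact: H.
have rD n : lq_le q (level_lp (r n)) D.
  by apply: lq_le_mono (rC n) => //; rewrite ?addr_ge0// lerD2l.
have ag n : series (real_level (r n) (a n)) @ \oo --> g n by have [_ _ _ H] := raP n; exact: H.
have [k ki [r' [a' [r'0 a'A ra']]]] := coefficients_subsequence D0 r_ge0 aA rD.
have r'C : lq_le q (level_lp r') C.
  apply: (lq_le_lim q0 (x := fun n => level_lp (r (k n)))
    (D := fun n => C + (k n).+1%:R^-1)).
  - by move=> n j; exact: level_lp_ge0.
  - by move=> n; rewrite addr_ge0.
  - by move=> j; apply: level_lp_cvg => // Q /ra'[].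
  - rewrite -[X in _ --> X]addr0; apply: cvgD; first exact: cvg_cst.
    exact: (cvg_comp _ _ (increasing_cvg ki) cvg_harmonic).
  - by move=> n; exact: rC.
have [h a'h] := Lp_series_cvg (levels_summable C0 r'0 a'A r'C).
exists k => //; exists h; first by exists r', a'.
apply: (mode_approx mc) => e e0.
have [N NP] := uniform_tail D0 e0.
exists (fun n => series (real_level (r (k n)) (a (k n))) N), (series (real_level r' a') N).
split.
- apply: (mode_sum mc) => j _; rewrite /real_level /level_sum.
  apply: (mode_sum (F := fun Q n => (r (k n) Q)%:C%C *: a (k n) Q) mc) => Q QP.
  have gQ : in_grid P Q by exists j.
  by have [rQ aQ] := ra' Q gQ; exact: mode_scale.
- by move=> n; apply: Lp_norm_series_tail (ag (k n)) _ => j; exact: NP.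
apply: Lp_norm_series_tail a'h _ => j; apply: NP => //.
by apply: lq_le_mono r'C => //; rewrite /D lerDl.
Qed.

(** Compactness applied to the constant sequence [g], with representations of cost tending to
    [C]. *)
Lemma besov_attained (C : R) (g : L) : besov P q A g -> besov_norm P q A g <= C ->
  representable C g.
Proof.
move=> gB gC; have C0 : 0 <= C := le_trans (besov_norm_ge0 g) gC.
have [|k ki [h hC gh]] := @besov_subsequence C (fun=> g) C0.
  by move=> n; apply: besov_representable => //; rewrite invr_gt0.
suff -> : g = h by [].
apply: (@mode_unique _ _ _ _ _ _ _ mc (fun=> g)) => //; exact: (mode_cst mc).
Qed.

Lemma besov_optimal g : besov P q A g -> representable (besov_norm P q A g) g.
Proof. by move=> gB; apply: besov_attained. Qed.

Lemma besov_bounded_subsequence (C : R) (g : nat -> L) :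
  (forall n, besov P q A (g n) /\ besov_norm P q A (g n) <= C) ->
  exists2 k : nat -> nat, increasing_seq k &
    exists h, [/\ conv (g \o k) h, besov P q A h & besov_norm P q A h <= C].
Proof.
move=> gC; have C0 : 0 <= C := le_trans (besov_norm_ge0 (g 0%N)) (gC 0%N).2.
have [|k ki [h hC gh]] := @besov_subsequence C g C0.
  by move=> n; have [gB gnC] := gC n; apply: besov_representable => //; rewrite invr_gt0.
by exists k => //; exists h; have [? ?] := representable_besov C0 hC; split.
Qed.

Lemma besovZ z g : besov P q A g -> besov P q A (z *: g) /\
  besov_norm P q A (z *: g) <= normc z * besov_norm P q A g.
Proof.
move=> gB; apply: representable_besov; first by rewrite mulr_ge0 ?normc_ge0 ?besov_norm_ge0.
by apply: representableZ; [exact: besov_norm_ge0|exact: besov_optimal].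
Qed.

(** The inequality of [besovZ] for [z] and for its inverse. *)
Lemma besov_normZ z g : besov P q A g ->
  besov_norm P q A (z *: g) = normc z * besov_norm P q A g.
Proof.
move=> gB; have [zB zN] := besovZ z gB; apply/eqP; rewrite eq_le zN/=.
have [->|z0] := eqVneq z 0; first by rewrite Normc.normc0 mul0r besov_norm_ge0.
have nz : normc z != 0 by apply: contra z0 => /eqP/Normc.eq0_normc ->.
have [_] := besovZ z^-1 zB; rewrite scalerA mulVf// scale1r => gN.
apply: (le_trans (ler_wpM2l (normc_ge0 z) gN)).
by rewrite mulrA -Normc.normcM divff// Normc.normc1 mul1r.
Qed.

Lemma besovD rho f g : 0 < rho <= 1 -> rho <= p -> (rho%:E <= q)%E ->
  besov P q A f -> besov P q A g -> besov P q A (f + g) /\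
  besov_norm P q A (f + g) `^ rho <=
    besov_norm P q A f `^ rho + besov_norm P q A g `^ rho.
Proof.
move=> rho01 rhop rhoq fB gB; have /andP[rho_gt0 _] := rho01.
have [fgB fgN] := representable_besov (powR_ge0 _ _)
  (representableD (besov_norm_ge0 f) (besov_norm_ge0 g) rho01 rhop rhoq
    (besov_optimal fB) (besov_optimal gB)).
split=> //; rewrite -[leRHS](@powRKV _ _ rho) ?gt_eqF ?addr_ge0 ?powR_ge0//.
by apply: le_powR fgN; [exact: ltW|exact: besov_norm_ge0].
Qed.

(* A limit of a subsequence is the limit of the whole Cauchy sequence because the
   closed balls are sequentially closed: apply the compactness of balls once more,
   to [u n - u (k j)] with [n] fixed. *)
Lemma besov_complete rho : 0 < rho <= 1 -> rho <= p -> (rho%:E <= q)%E ->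
  rho_complete rho (besov P q A) (besov_norm P q A).
Proof.
move=> rho01 rhop rhoq v vB cauchy; have /andP[rho_gt0 _] := rho01.
have subB f g : besov P q A f -> besov P q A g -> besov P q A (f - g).
  move=> fB gB; have [+ _] := besovZ (-1) gB; rewrite scaleN1r => ngB.
  by have [] := besovD rho01 rhop rhoq fB ngB.
have [n0 n0P] := cauchy 1 ltr01.
pose C := (1 + besov_norm P q A (v n0) `^ rho) `^ rho^-1.
(* Beyond [n0] the terms are within distance 1 of [v n0], hence bounded by [C]. *)
have [|k ki [f [vf fB _]]] := @besov_bounded_subsequence C (fun n => v (n + n0)%N).
  move=> n; split; first exact: vB.
  apply: (powR_le_inv rho_gt0); rewrite ?besov_norm_ge0 ?powR_ge0//.
  rewrite powRKV ?gt_eqF ?addr_ge0 ?powR_ge0// -(subrK (v n0) (v (n + n0)%N)).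
  have [_ h] := besovD rho01 rhop rhoq (subB _ _ (vB (n + n0)%N) (vB n0)) (vB n0).
  by apply: (le_trans h); rewrite lerD2r ltW// n0P// leq_addl.
exists f => //; apply/cvgrPdist_lt => e e0.
have e20 : 0 < e / 2 by rewrite divr_gt0.
have [n1 n1P] := cauchy _ e20.
exists n1 => // n /= n1n; rewrite sub0r normrN ger0_norm ?powR_ge0//.
(* The shift by [n1] pushes the index past [n1], as [k i >= i], so every [w j] is in the ball of
   radius [(e / 2)^(1 / rho)]. *)
pose w j := v n - v (k (j + n1)%N + n0)%N.
have [|k' k'i [h [wh hB hN]]] := @besov_bounded_subsequence ((e / 2) `^ rho^-1) w.
  move=> j; split; first exact: subB.
  apply: (powR_le_inv rho_gt0); rewrite ?besov_norm_ge0 ?powR_ge0//.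
  rewrite powRKV ?gt_eqF ?(ltW e20)// ltW// n1P//.
  by rewrite (leq_trans _ (leq_addr _ _))// (leq_trans _ (increasing_seq_ge _ ki))// leq_addl.
have -> : v n - f = h.
  apply: (mode_unique mc _ wh).
  have shift_inc : increasing_seq (fun j => (j + n1)%N : nat).
    by apply: increasing_seqS => j; rewrite addSn.
  have c1 := mode_sub mc k'i (mode_sub mc shift_inc vf).
  have m1 : (fun=> -1 : R) j @[j --> \oo] --> (-1 : R) by exact: cvg_cst.
  have c2 := mode_add mc (mode_cst mc (v n)) (mode_scale mc m1 c1).
  have -> : v n - f = v n + (-1)%:C%C *: f by rewrite rmorphN1 scaleN1r.
  rewrite (_ : w \o k' = fun j => v n + (-1)%:C%C *: v (k (k' j + n1) + n0)%N)//.
  by apply/funext => j /=; rewrite rmorphN1 scaleN1r.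
rewrite (@le_lt_trans _ _ (e / 2)) ?ltr_pdivrMr ?ltr_pMr ?ltr1n//.
rewrite -[leRHS](@powRKV _ _ rho) ?gt_eqF ?(ltW e20)//.
by apply: le_powR hN; [exact: ltW|exact: besov_norm_ge0].
Qed.

Lemma besov_rho_banach rho : 0 < rho <= 1 -> rho <= p -> (rho%:E <= q)%E ->
  rho_banach rho (besov P q A) (besov_norm P q A).
Proof.
move=> rho01 rhop rhoq; split.
- by have [] := representable_besov (lexx 0) representable0.
- move=> z f g fB gB; have [zfB _] := besovZ z fB.
  by have [] := besovD rho01 rhop rhoq zfB gB.
- split.
  + by move=> f _; exact: besov_norm_ge0.
  + by move=> z f; exact: besov_normZ.
  + by move=> f g fB gB; have [] := besovD rho01 rhop rhoq fB gB.
  + move=> f fB f0; apply: representable_eq0; rewrite -[X in representable X _]f0.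
    exact: besov_optimal.
exact: besov_complete.
Qed.

End mode.

Lemma besov_compact_inclusion : (forall Q, in_grid P Q -> compact (A Q)) ->
  compact_linear_map (besov P q A) (besov_norm P q A) id.
Proof.
move=> cA; split=> // X XB [M XM].
have Ac Q : in_grid P Q -> mode_compact (@strong_cvg _ T R m p p0) (A Q).
  by move=> gQ; exact: compact_sequentially_compact (cA Q gQ).
pose K := [set f | besov P q A f /\ besov_norm P q A f <= M].
have cK : compact K.
  apply: sequentially_compact_compact => v vK.
  have [k ki [h [vh hB hM]]] := besov_bounded_subsequence (strong_mode m p0) Ac vK.
  by exists k => //; exists h.
apply: (@precompact_subset _ _ K).
  by move=> _ [f Xf <-]; split; [exact: XB|exact: XM].
by apply: compact_precompact cK; exact: metric_hausdorff.
Qed.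
End besov_compactness.

Theorem corollary6p5 (R : realType) (d : measure_display) (T : measurableType d)
    (m : {finite_measure set T -> \bar R})
    (s p : R) (q u : \bar R)
    (s0 : 0 < s) (p0 : 0 < p) (q0 : (0 < q)%E) (u1 : (1 <= u)%E)
    (P : nat -> {fset set T})
    (gridP : grid m P) (g1P : G1 P) (g2P : G2 m s p q P)
    (B : set T -> set (Lp m p0)) (NB : set T -> Lp m p0 -> R)
    (A : set T -> set (Lp m p0)) (atomsA : atoms P s u B NB A) :
  let case1 := forall Q, in_grid P Q -> compact (A Q) in
  let case2 := 1 <= p /\
    forall Q, in_grid P Q -> weakly_sequentially_compact (A Q) in
  case1 \/ case2 ->
  [/\ (forall (C : R) (g_ : nat -> Lp m p0),
        (forall n, besov P q A (g_ n) /\ besov_norm P q A (g_ n) <= C) ->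
        (case1 -> exists2 k : nat -> nat, increasing_seq k &
           exists g : Lp m p0, [/\ g_ (k n) @[n --> \oo] --> g,
             besov P q A g & besov_norm P q A g <= C]) /\
        (case2 -> exists2 k : nat -> nat, increasing_seq k &
           exists g : Lp m p0,
             [/\ (g_ (k n) : weak_Lp m p0) @[n --> \oo] --> (g : weak_Lp m p0),
             besov P q A g & besov_norm P q A g <= C])),
      rho_banach (fine (Order.min 1%:E (Order.min p%:E q)))
        (besov P q A) (besov_norm P q A)
    & case1 -> compact_linear_map (besov P q A) (besov_norm P q A) id].
Proof.
move=> case1 case2 case12.
(* The minimum is taken in the extended reals as [q] may be [+oo]; the entry 1 keeps it finite. *)
have rhoE : exists rho : R, [/\ (rho%:E = Order.min 1%:E (Order.min p%:E q))%E,
    0 < rho <= 1, rho <= p & (rho%:E <= q)%E].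
  set x := Order.min 1%:E _.
  have x0 : (0 < x)%E by rewrite !lt_min lte01 lte_fin p0 q0.
  have x1 : (x <= 1%:E)%E by rewrite ge_min lexx.
  have xp : (x <= p%:E)%E by rewrite !ge_min lexx !orbT.
  have xq : (x <= q)%E by rewrite !ge_min lexx !orbT.
  have xfin : (fine x)%:E = x.
    by rewrite fineK// ge0_fin_numE ?(ltW x0)//; exact: le_lt_trans x1 (ltry _).
  exists (fine x); rewrite -!lee_fin -lte_fin xfin; split=> //.
  by rewrite x0.
have [rho [<- rho01 rhop rhoq]] := rhoE.
have Ac1 : case1 -> forall Q, in_grid P Q -> mode_compact (@strong_cvg _ T R m p p0) (A Q).
  by move=> c1 Q gQ; exact: compact_sequentially_compact (c1 Q gQ).
have Ac2 : case2 -> forall Q, in_grid P Q -> mode_compact (@weak_cvg _ T R m p p0) (A Q).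
  by move=> [_ c2] Q gQ; exact: c2.
split.
- move=> C g_ gC; split=> c.
    exact: (besov_bounded_subsequence s0 q0 u1 gridP g1P g2P atomsA (strong_mode m p0) (Ac1 c) gC).
  exact: (besov_bounded_subsequence s0 q0 u1 gridP g1P g2P atomsA (weak_mode m p0 c.1) (Ac2 c) gC).
- case: case12 => c.
    exact: (besov_rho_banach s0 q0 u1 gridP g1P g2P atomsA (strong_mode m p0) (Ac1 c) rho01 rhop rhoq).
  exact: (besov_rho_banach s0 q0 u1 gridP g1P g2P atomsA (weak_mode m p0 c.1) (Ac2 c) rho01 rhop rhoq).
- exact: (besov_compact_inclusion s0 q0 u1 gridP g1P g2P atomsA).
Qed.
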